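(* $\mathcal{T}_{h+1}$-Free Edge Deletion is fixed-parameter tractable when parameterized by the size $\ell$ of a vertex deletion set to a clique, i.e. a set $X\subseteq V(G)$ such that $G-X$ is a complete graph.
   Context: $\mathcal{T}_{h+1}$-Free Edge Deletion: given a simple undirected graph $G$ and positive integers $k,h$, decide whether there is $F\subseteq E(G)$ with $|F|\le k$ such that every connected component of $G\setminus F$ has at most $h$ vertices. *)

(* Defs.v *)
From mathcomp Require Import all_boot.

Set Implicit Arguments.
Unset Strict Implicit.
Unset Printing Implicit Defensive.

(** * Unit-cost random access machines

    Structured RAM programs over the natural numbers.  A program uses finitely
    many arrays, named by numerals; a register is cell 0 of an array.
    Addresses may be computed (indirect addressing).  The only arithmetic is
    addition and truncated subtraction: without multiplication, the operands
    after [t] steps have at most [t + O(1)] more bits than the input words, so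
    that unit cost is polynomially related to Turing machine time. *)

Definition memory := nat -> nat -> nat.

Inductive expr :=
| Const of nat
| Get of nat & expr
| Add of expr & expr
| Sub of expr & expr.

Inductive cmd :=
| Skip
| Put of nat & expr & expr
| Seq of cmd & cmd
| If of expr & cmd & cmd
| While of expr & cmd.

Fixpoint eval (m : memory) (e : expr) : nat :=
  match e with
  | Const n => n
  | Get a i => m a (eval m i)
  | Add e1 e2 => eval m e1 + eval m e2
  | Sub e1 e2 => eval m e1 - eval m e2
  end.

Fixpoint expr_cost (e : expr) : nat :=
  match e with
  | Const _ => 1
  | Get _ i => (expr_cost i).+1
  | Add e1 e2 | Sub e1 e2 => (expr_cost e1 + expr_cost e2).+1
  end.

Definition update (m : memory) (a i v : nat) : memory :=
  fun b j => if (b == a) && (j == i) then v else m b j.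

(** [exec c m t m']: started in memory [m], the program [c] halts after
    exactly [t] steps in memory [m'].  Tests succeed on nonzero values. *)
Inductive exec : cmd -> memory -> nat -> memory -> Prop :=
| exec_skip m : exec Skip m 1 m
| exec_put a i e m :
    exec (Put a i e) m (expr_cost i + expr_cost e).+1
      (update m a (eval m i) (eval m e))
| exec_seq c1 c2 m1 t1 m2 t2 m3 :
    exec c1 m1 t1 m2 -> exec c2 m2 t2 m3 ->
    exec (Seq c1 c2) m1 (t1 + t2).+1 m3
| exec_if e c1 c2 m t m' :
    exec (if eval m e != 0 then c1 else c2) m t m' ->
    exec (If e c1 c2) m (expr_cost e + t).+1 m'
| exec_while_stop e c m :
    eval m e = 0 -> exec (While e c) m (expr_cost e).+1 m
| exec_while_step e c m1 t1 m2 t2 m3 :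
    eval m1 e != 0 -> exec c m1 t1 m2 -> exec (While e c) m2 t2 m3 ->
    exec (While e c) m1 (expr_cost e + t1 + t2).+1 m3.

Lemma exec_deterministic c m t1 m1 t2 m2 :
  exec c m t1 m1 -> exec c m t2 m2 -> t1 = t2 /\ m1 = m2.
Proof.
move=> H; elim: H t2 m2 => {c m t1 m1}.
- by move=> m t m' H; inversion H.
- by move=> a i e m t m' H; inversion H.
- move=> c1 c2 m1 t1 m2 t2 m3 _ IH1 _ IH2 t m' H.
  inversion H as [| | ? ? ? ? ? ? ? E1 E2 | | |]; subst.
  by have [? ?] := IH1 _ _ E1; subst; have [-> ->] := IH2 _ _ E2.
- move=> e c1 c2 m t m' _ IH t2 m2 H.
  inversion H as [| | | ? ? ? ? ? ? E | |]; subst.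
  by have [-> ->] := IH _ _ E.
- move=> e c m e0 t m' H.
  inversion H as [| | | | | ? ? ? ? ? ? ? E]; subst => //.
  by rewrite e0 in E.
- move=> e c m1 t1 m2 t2 m3 e1 _ IH1 _ IH2 t m' H.
  inversion H as [| | | | ? ? ? E | ? ? ? ? ? ? ? E E1 E2]; subst.
    by rewrite E in e1.
  by have [? ?] := IH1 _ _ E1; subst; have [-> ->] := IH2 _ _ E2.
Qed.

(** The input words are stored in array 0, every other cell holds 0; the
    output is read off cell 0 of array 0. *)
Definition load (w : seq nat) : memory :=
  fun a i => if a == 0 then nth 0 w i else 0.

Definition output (m : memory) : nat := m 0 0.

(** Total number of binary digits of the input words. *)
Definition input_size (w : seq nat) : nat :=
  \sum_(x <- w) (trunc_log 2 x).+1.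

Definition computable (f : nat -> nat) : Prop :=
  exists p : cmd, forall n : nat,
    exists t m, exec p (load [:: n]) t m /\ output m = f n.

(** * Fixed-parameter tractability

    The problem with instances [I], encoded by [code], yes-instances [yes] and
    parameter [par], is decidable in time [f (par x) * |x| ^ O(1)] with [f]
    computable.  The algorithm receives the instance only. *)
Definition fpt (I : Type) (code : I -> seq nat) (yes : I -> Prop)
    (par : I -> nat) : Prop :=
  exists f : nat -> nat, computable f /\
  exists (p : cmd) (c : nat), forall x : I,
    exists t m,
      [/\ exec p (load (code x)) t m,
          t <= f (par x) * input_size (code x) ^ c
        & 0 < output m <-> yes x].

(** * Graphs *)

Record sgraph := SGraph {
  num_verts : nat;
  adj : rel 'I_num_verts;
  adj_sym : symmetric adj;
  adj_irr : irreflexive adj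
}.

Definition edges (G : sgraph) : {set {set 'I_(num_verts G)}} :=
  [set e | [exists u, exists v, adj u v && (e == [set u; v])]].

Definition adj_del (G : sgraph) (F : {set {set 'I_(num_verts G)}}) :
    rel 'I_(num_verts G) :=
  fun u v => adj u v && ([set u; v] \notin F).

Definition components (n : nat) (e : rel 'I_n) : {set {set 'I_n}} :=
  equivalence_partition (connect e) [set: 'I_n].

Definition clique_deletion_set (G : sgraph) (X : {set 'I_(num_verts G)}) : bool :=
  [forall u, forall v,
    [&& u \notin X, v \notin X & u != v] ==> adj u v].

(** Deleting all vertices always works, so the minimum exists. *)
Definition clique_distance (G : sgraph) : nat :=
  #|[arg min_(X < [set: 'I_(num_verts G)] | clique_deletion_set X) #|X| ]|.

Lemma clique_distanceP (G : sgraph) :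
  (exists2 X : {set 'I_(num_verts G)},
     clique_deletion_set X & #|X| = clique_distance G) /\
  (forall X : {set 'I_(num_verts G)},
     clique_deletion_set X -> clique_distance G <= #|X|).
Proof.
rewrite /clique_distance; case: arg_minnP => [|X cX minX].
  by apply/forallP=> u; apply/forallP=> v; rewrite in_setT.
by split; [exists X | exact: minX].
Qed.

(** * The edge deletion problem *)

Record instance := Instance {
  graph : sgraph;
  budget : nat;
  bound : nat;
  budget_gt0 : 0 < budget;
  bound_gt0 : 0 < bound
}.

Definition tree_free_edge_deletion (x : instance) : Prop :=
  exists F : {set {set 'I_(num_verts (graph x))}},
    [/\ F \subset edges (graph x),
        #|F| <= budget x
      & forall C, C \in components (adj_del F) -> #|C| <= bound x].

(** The words [n], [k], [h], then the adjacency matrix, row by row. *)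
Definition encode (x : instance) : seq nat :=
  [:: num_verts (graph x), budget x, bound x
    & [seq nat_of_bool (adj u v) | u <- enum 'I_(num_verts (graph x)),
                                   v <- enum 'I_(num_verts (graph x))]].

(* Main.v *)
Require Import Defs.
From mathcomp Require Import all_boot.
From mathcomp Require Import zify.
From Stdlib Require Import Classical.

Set Implicit Arguments.
Unset Strict Implicit.
Unset Printing Implicit Defensive.

(** Greedily matching nonadjacent vertices gives a set [X] of [s] vertices, at
    most twice the minimum, whose complement [K] is a clique.  A solution is
    a labelling of the vertices with classes of size at most [h]; up to
    relabelling, the classes meeting [X] are the blocks [0 .. s-1], and the
    remaining vertices, all in [K], are best packed into classes of size
    exactly [h], apart from one.

    Moving [s + 1] vertices of [K] from a block to a larger one gains more
    pairs than it can cost, so in an optimal labelling all blocks but one have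
    size at most [2s] or at least [h - s].  Hence the labels of [X] and the
    block sizes take few values, apart from a single size that ranges over
    [0 .. n].  Once they are fixed, distributing [K] over the blocks is a
    transportation problem with costs at most [s].  By duality its optimum is
    the maximum, over integral prices of the blocks bounded by [s (s + 1)], of
    an expression that is computed vertex by vertex.  The algorithm thus
    decides whether, for some labels and sizes, an inequality holds for all
    prices; both sides are enumerated as digits of numbers below a bound that
    depends on [s] only. *)

(** * Terms and their compilation *)

(** A min-cost flow algorithm would need a correctness proof as a machine program. Duality avoids
    this: that some [y], [w] pass the test for every [z] is evaluated by nested counting loops, so
    bounded folds suffice. A fixed term runs in time polynomial in its loop bounds, here of order
    [N + n] with [N] codes; once [N] is bounded in the parameter, this is fixed-parameter time.

    Budget and bound are written in binary and may be exponential in the input size. So [k] is only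
    added, while [h] is cut down to [n + 1], since block sizes close to it bound loops.

    Ordered pairs are counted throughout. Twice the cut is the number of adjacent pairs, plus the
    nonadjacent pairs inside classes, diagonal included, minus the squares of the class sizes. Since
    [K] is a clique, its vertices enter only through class sizes, a constant, and nonadjacent pairs
    with [X]. With sizes and labels of [X] fixed, the last term is a sum over [K] of costs that
    depend on one label each.

    A price is the gain of shifting vertices along a route through distinct labels. There are
    [s + 1] labels and a vertex gains at most [s], whence the bound. *)

Inductive term :=
| TConst of nat
| TVar of nat
| TGet of nat & term
| TAdd of term & term
| TSub of term & term
| TFold of term & term & term
| TCall of term & term & term & term.

(** [TFold b i e] iterates [e] from the value of [i]; inside [e], variable 0
    is the loop index and variable 1 the accumulator.  [TCall f a b c] runs
    [f] in the environment formed by the three arguments only.  In [ev W D],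
    [D] holds the arrays that terms can read and [W] bounds every loop. *)
Inductive ev (W : nat) (D : memory) : seq nat -> term -> nat -> Prop :=
| ev_const env n : ev W D env (TConst n) n
| ev_var env i : i < size env -> ev W D env (TVar i) (nth 0 env i)
| ev_get env a e v : a < 2 -> ev W D env e v -> ev W D env (TGet a e) (D a v)
| ev_add env e1 e2 v1 v2 :
    ev W D env e1 v1 -> ev W D env e2 v2 -> ev W D env (TAdd e1 e2) (v1 + v2)
| ev_sub env e1 e2 v1 v2 :
    ev W D env e1 v1 -> ev W D env e2 v2 -> ev W D env (TSub e1 e2) (v1 - v2)
| ev_fold env b i e N (acc : nat -> nat) :
    ev W D env b N -> N <= W -> ev W D env i (acc 0) ->
    (forall j, j < N -> ev W D [:: j, acc j & env] e (acc j.+1)) ->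
    ev W D env (TFold b i e) (acc N)
| ev_call env f a b c va vb vc v :
    ev W D env a va -> ev W D env b vb -> ev W D env c vc ->
    ev W D [:: va; vb; vc] f v -> ev W D env (TCall f a b c) v.

Definition reg (a : nat) : expr := Get a (Const 0).
Definition set_reg (a : nat) (e : expr) : cmd := Put a (Const 0) e.

(** [rho] gives the registers of the variables and [top] the first free one, where the value ends
    up. A fold keeps its accumulator, index and bound in [top], [top.+1] and [top.+2]. Allocation is
    static, so finitely many arrays are used. *)
Fixpoint compile (rho : seq nat) (top : nat) (e : term) : cmd :=
  match e with
  | TConst n => set_reg top (Const n)
  | TVar i => set_reg top (reg (nth 0 rho i))
  | TGet a e => Seq (compile rho top e) (set_reg top (Get a (reg top)))
  | TAdd e1 e2 =>
      Seq (compile rho top e1) (Seq (compile rho top.+1 e2)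
        (set_reg top (Add (reg top) (reg top.+1))))
  | TSub e1 e2 =>
      Seq (compile rho top e1) (Seq (compile rho top.+1 e2)
        (set_reg top (Defs.Sub (reg top) (reg top.+1))))
  | TFold b i e =>
      Seq (compile rho top i) (Seq (compile rho top.+2 b)
        (Seq (set_reg top.+1 (Const 0))
          (While (Defs.Sub (reg top.+2) (reg top.+1))
            (Seq (compile [:: top.+1, top & rho] top.+3 e)
              (Seq (set_reg top (reg top.+3))
                (set_reg top.+1 (Add (reg top.+1) (Const 1))))))))
  | TCall f a b c =>
      Seq (compile rho top a) (Seq (compile rho top.+1 b)
        (Seq (compile rho top.+2 c)
          (Seq (compile [:: top; top.+1; top.+2] top.+3 f)
            (set_reg top (reg top.+3)))))
  end.

Fixpoint time (W : nat) (e : term) : nat :=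
  match e with
  | TConst _ | TVar _ => 10
  | TGet _ e => time W e + 10
  | TAdd e1 e2 | TSub e1 e2 => time W e1 + time W e2 + 20
  | TFold b i e => time W b + time W i + W * (time W e + 30) + 30
  | TCall f a b c => time W f + time W a + time W b + time W c + 30
  end.

(** * Programs that halt within a time bound *)

Definition runs (c : cmd) (m : memory) (T : nat) (Q : memory -> Prop) : Prop :=
  exists t m', [/\ exec c m t m', t <= T & Q m'].


Lemma runs_seq c1 c2 m T1 T2 T (P Q : memory -> Prop) :
  runs c1 m T1 P -> (forall m1, P m1 -> runs c2 m1 T2 Q) -> T1 + T2 < T ->
  runs (Seq c1 c2) m T Q.
Proof.
move=> [t1 [m1 [E1 l1 /[swap] /[apply]]]] [t2 [m2 [E2 l2 q]]] lT.
exists (t1 + t2).+1, m2; split=> //; last by lia.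
exact: exec_seq E1 E2.
Qed.

Lemma runs_set_reg a e m T (Q : memory -> Prop) :
  Q (update m a 0 (eval m e)) -> expr_cost e + 2 <= T ->
  runs (set_reg a e) m T Q.
Proof.
move=> q lT; exists (1 + expr_cost e).+1, (update m a 0 (eval m e)).
by split=> //; [exact: exec_put | lia].
Qed.

Lemma runs_weaken c m T T' (P Q : memory -> Prop) :
  T <= T' -> (forall m', P m' -> Q m') -> runs c m T P -> runs c m T' Q.
Proof.
move=> lT PQ [t [m' [E l p]]]; exists t, m'; split=> //; [exact: leq_trans lT|].
exact: PQ.
Qed.

Lemma runs_for b idx c N T T' m (I : nat -> memory -> Prop) :
  (forall j m1, I j m1 -> eval m1 b = N /\ m1 idx 0 = j) ->
  (forall j m1, j < N -> I j m1 -> runs c m1 T (I j.+1)) ->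
  I 0 m -> N * (T + expr_cost b + 4) + (expr_cost b + 4) <= T' ->
  runs (While (Defs.Sub b (reg idx)) c) m T' (I N).
Proof.
move=> Ib step I0 lT.
suff H : forall r j m1, j + r = N -> I j m1 ->
    runs (While (Defs.Sub b (reg idx)) c) m1
      (r * (T + expr_cost b + 4) + (expr_cost b + 4)) (I N).
  have [t [m' [E l q]]] := H _ _ _ (add0n N) I0.
  by exists t, m'; split=> //; exact: leq_trans lT.
elim=> [|r IH] j m1 jr Ij; have [eb ej] := Ib _ _ Ij.
  rewrite addn0 in jr; subst j.
  exists (expr_cost (Defs.Sub b (reg idx))).+1, m1.
  split=> //=; last by rewrite jr in Ij.
    by apply: exec_while_stop; rewrite /= eb jr subnn.
  by rewrite mul0n; lia.
have jN : j < N by lia.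
have [t1 [m2 [E1 l1 q1]]] := step _ _ jN Ij.
have jr' : j.+1 + r = N by lia.
have [t2 [m3 [E2 l2 q2]]] := IH _ _ jr' q1.
exists (expr_cost (Defs.Sub b (reg idx)) + t1 + t2).+1, m3.
split=> //; last by rewrite mulSn /=; lia.
apply: exec_while_step E1 E2.
by rewrite /= eb ej; lia.
Qed.

(** The frame condition keeps variables, arrays 0 and 1 and earlier partial results intact while the
    next subterm is computed. *)
Definition yields (top v : nat) (m m' : memory) : Prop :=
  m' top 0 = v /\ forall a i, a < top -> m' a i = m a i.

Lemma yields_update top v m m1 :
  (forall a i, a < top -> m1 a i = m a i) -> yields top v m (update m1 top 0 v).
Proof.
move=> H; rewrite /yields /update !eqxx; split=> // a i lt.
by rewrite (ltn_eqF lt) H.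
Qed.

Lemma map_cells rho top (m m1 : memory) :
  all (fun a => a < top) rho -> (forall a i, a < top -> m1 a i = m a i) ->
  [seq m1 a 0 | a <- rho] = [seq m a 0 | a <- rho].
Proof. by move=> /allP rt mm; apply/eq_in_map => a /rt /mm. Qed.

Lemma all_lt_weaken rho t t' :
  t <= t' -> all (fun a => a < t) rho -> all (fun a => a < t') rho.
Proof. by move=> lt; apply: sub_all => a at_; exact: leq_trans lt. Qed.

(** The induction is on the evaluation, not on the term: a fold body is evaluated in a new
    environment at each round. *)
Lemma runs_compile W D rho top e m env v :
  ev W D env e v -> 2 <= top -> all (fun a => a < top) rho ->
  env = [seq m a 0 | a <- rho] -> (forall a i, a < 2 -> m a i = D a i) ->
  runs (compile rho top e) m (time W e) (yields top v m).
Proof.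
move=> H; elim: H rho top m => {env e v}.
- move=> env n rho top m t2 rt _ _.
  by apply: runs_set_reg => //; exact: yields_update.
- move=> env k ks rho top m t2 rt E _; rewrite E size_map in ks.
  apply: runs_set_reg => //=; rewrite E (nth_map 0) //; exact: yields_update.
- move=> env a e v a2 _ IH rho top m t2 rt E mD.
  apply: (runs_seq (T2 := 9) (IH rho top m t2 rt E mD)) => [m1 [v1 f1]|/=];
    last by lia.
  apply: runs_set_reg => //=.
  by rewrite v1 f1 ?mD ?(leq_trans a2) //; exact: yields_update.
- move=> env e1 e2 v1 v2 _ IH1 _ IH2 rho top m t2 rt E mD.
  apply: (runs_seq (T2 := time W e2 + 15) (IH1 rho top m t2 rt E mD)) =>
    [m1 [r1 f1]|/=]; last by lia.
  apply: (runs_seq (T2 := 10) (IH2 rho top.+1 m1 _ _ _ _)).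
  + by lia.
  + by apply: all_lt_weaken rt; lia.
  + by rewrite E; exact: esym (map_cells rt f1).
  + by move=> a i a2; rewrite f1 ?mD //; lia.
  + move=> m2 [r2 f2]; apply: runs_set_reg => //=.
    rewrite r2 f2 // r1; apply: yields_update => a i lt.
    by rewrite f2 ?f1 //; lia.
  + by lia.
- move=> env e1 e2 v1 v2 _ IH1 _ IH2 rho top m t2 rt E mD.
  apply: (runs_seq (T2 := time W e2 + 15) (IH1 rho top m t2 rt E mD)) =>
    [m1 [r1 f1]|/=]; last by lia.
  apply: (runs_seq (T2 := 10) (IH2 rho top.+1 m1 _ _ _ _)).
  + by lia.
  + by apply: all_lt_weaken rt; lia.
  + by rewrite E; exact: esym (map_cells rt f1).
  + by move=> a i a2; rewrite f1 ?mD //; lia.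
  + move=> m2 [r2 f2]; apply: runs_set_reg => //=.
    rewrite r2 f2 // r1; apply: yields_update => a i lt.
    by rewrite f2 ?f1 //; lia.
  + by lia.
- move=> env b i e N acc _ IHb NW _ IHi _ IHe rho top m t2 rt E mD.
  apply: (runs_seq (T2 := time W b + W * (time W e + 30) + 29)
            (IHi rho top m t2 rt E mD)) => [m1 [r1 f1]|/=]; last by lia.
  apply: (runs_seq (T2 := W * (time W e + 30) + 28) (IHb rho top.+2 m1 _ _ _ _)).
  + by lia.
  + by apply: all_lt_weaken rt; lia.
  + by rewrite E; exact: esym (map_cells rt f1).
  + by move=> a j a2; rewrite f1 ?mD //; lia.
  + move=> m2 [r2 f2].
    pose I j m' := [/\ m' top 0 = acc j, m' top.+1 0 = j, m' top.+2 0 = N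
                    & forall a x, a < top -> m' a x = m a x].
    apply: (runs_seq (T1 := 3) (T2 := W * (time W e + 30) + 20) (P := I 0)).
    * apply: runs_set_reg => //=; rewrite /I /update !eqxx /=.
      split; rewrite ?(ltn_eqF (ltnSn _)) ?(gtn_eqF (ltnSn _)) //=.
        by rewrite f2 // r1.
      move=> a x lt; rewrite (ltn_eqF (_ : a < top.+1)) /= ?f2 ?f1 //; lia.
    * move=> m3 I3.
      apply: (@runs_weaken _ _ _ _ (I N)); first exact: leqnn.
        by move=> m' [? _ _ ?].
      apply: (runs_for (N := N) (T := time W e + 20)) I3 _.
      - by move=> j m4 [_ ? ? _].
      - move=> j m4 jN [a4 j4 l4 f4].
        apply: (runs_seq (T2 := 15) (IHe j jN [:: top.+1, top & rho] top.+3 m4 _ _ _ _)).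
        + by lia.
        + by rewrite /=; apply/and3P; split; [lia | lia | apply: all_lt_weaken rt; lia].
        + by rewrite /= j4 a4 E; congr [:: _, _ & _]; exact: esym (map_cells rt f4).
        + by move=> a x a2; rewrite f4 ?mD //; lia.
        + move=> m5 [r5 f5].
          apply: (runs_seq (T1 := 4) (T2 := 8)
            (P := fun m' => [/\ m' top 0 = acc j.+1, m' top.+1 0 = j, m' top.+2 0 = N
                    & forall a x, a < top -> m' a x = m a x])) => //.
          * apply: runs_set_reg => //=; rewrite /update !eqxx /=.
            rewrite !gtn_eqF /= ?r5 ?f5 //; try lia.
            by split=> // a x lt; rewrite (ltn_eqF lt) /= f5 ?f4 //; lia.
          * move=> m6 [r6 j6 l6 f6]; apply: runs_set_reg => //=.
            rewrite /I /update !eqxx /= j6.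
            rewrite (ltn_eqF (ltnSn _)) (gtn_eqF (ltnSn _)) /= r6 l6 addn1.
            by split=> // a x lt; rewrite (ltn_eqF (_ : a < top.+1)) /= ?f6 //; lia.
        + by lia.
      - rewrite /=; have : N * (time W e + 30) <= W * (time W e + 30) by rewrite leq_mul2r NW orbT.
        have : N * (time W e + 20 + 2 + 4) <= N * (time W e + 30).
          by rewrite leq_mul2l; lia.
        by lia.
    * by lia.
  + by lia.
- move=> env f a b c va vb vc v _ IHa _ IHb _ IHc _ IHf rho top m t2 rt E mD.
  apply: (runs_seq (T2 := time W f + time W b + time W c + 29)
            (IHa rho top m t2 rt E mD)) => [m1 [r1 f1]|/=]; last by lia.
  apply: (runs_seq (T2 := time W f + time W c + 28) (IHb rho top.+1 m1 _ _ _ _)).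
  + by lia.
  + by apply: all_lt_weaken rt; lia.
  + by rewrite E; exact: esym (map_cells rt f1).
  + by move=> x i x2; rewrite f1 ?mD //; lia.
  + move=> m2 [r2 f2].
    have f2' x i : x < top -> m2 x i = m x i by move=> lt; rewrite f2 ?f1 //; lia.
    apply: (runs_seq (T2 := time W f + 27) (IHc rho top.+2 m2 _ _ _ _)).
    * by lia.
    * by apply: all_lt_weaken rt; lia.
    * by rewrite E; exact: esym (map_cells rt f2').
    * by move=> x i x2; rewrite f2' ?mD //; lia.
    * move=> m3 [r3 f3].
      have f3' x i : x < top -> m3 x i = m x i by move=> lt; rewrite f3 ?f2' //; lia.
      apply: (runs_seq (T2 := 10) (IHf [:: top; top.+1; top.+2] top.+3 m3 _ _ _ _)).
      - by lia.
      - by apply/and4P; split=> //; lia.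
      - by rewrite /= r3 !f3 ?r2 ?f2 ?r1 //; lia.
      - by move=> x i x2; rewrite f3' ?mD //; lia.
      - move=> m4 [r4 f4]; apply: runs_set_reg => //=.
        rewrite r4; apply: yields_update => x i lt.
        by rewrite f4 ?f3' //; lia.
      - by lia.
    * by lia.
  + by lia.
Qed.

(** [W] enters only as a factor at each fold, and the folds of a term are fixed, so the degree
    depends on the term alone. *)
Lemma time_poly e : exists C d, forall W, time W e <= C * W.+1 ^ d.
Proof.
have add (f g : nat -> nat) :
    (exists C d, forall W, f W <= C * W.+1 ^ d) ->
    (exists C d, forall W, g W <= C * W.+1 ^ d) ->
    exists C d, forall W, f W + g W <= C * W.+1 ^ d.
  move=> [C [d Hf]] [C' [d' Hg]]; exists (C + C'), (d + d') => W.
  rewrite mulnDl leq_add //.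
    by apply: leq_trans (Hf W) _; rewrite leq_mul2l leq_pexp2l ?leq_addr ?orbT.
  by apply: leq_trans (Hg W) _; rewrite leq_mul2l leq_pexp2l ?leq_addl ?orbT.
have cst c : exists C d, forall W, (fun _ => c) W <= C * W.+1 ^ d.
  by exists c, 0 => W; rewrite muln1.
have lin (f : nat -> nat) : (exists C d, forall W, f W <= C * W.+1 ^ d) ->
    exists C d, forall W, W * f W <= C * W.+1 ^ d.
  move=> [C [d Hf]]; exists C, d.+1 => W.
  by rewrite expnS mulnCA leq_mul.
elim: e => /=.
- by move=> _; exact: cst.
- by move=> _; exact: cst.
- by move=> _ e IH; exact: add IH (cst _).
- by move=> e1 I1 e2 I2; exact: add (add _ _ I1 I2) (cst _).
- by move=> e1 I1 e2 I2; exact: add (add _ _ I1 I2) (cst _).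
- move=> b Ib i Ii e Ie.
  exact: add (add _ _ (add _ _ Ib Ii) (lin _ (add _ _ Ie (cst _)))) (cst _).
- move=> f If a Ia b Ib c Ic.
  exact: add (add _ _ (add _ _ (add _ _ If Ia) Ib) Ic) (cst _).
Qed.

(** Array 1 is filled by [E], each entry from the previous ones, before
    [e] is run. *)
Definition program (E e : term) : cmd :=
  Seq (set_reg 2 (Const 0))
    (Seq (While (Defs.Sub (reg 0) (reg 2))
            (Seq (compile [:: 2] 3 E)
              (Seq (Put 1 (reg 2) (reg 3)) (set_reg 2 (Add (reg 2) (Const 1))))))
      (Seq (compile [::] 2 e) (set_reg 0 (reg 2)))).

(** Entry [u] is evaluated against the table cut at [u], which allows [P] to be a course-of-values
    recursion. *)
Definition table (w : seq nat) (P : nat -> nat) (u : nat) : memory :=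
  fun a i => if a == 0 then nth 0 w i
             else if (a == 1) && (i < u) then P i else 0.

Lemma runs_program W w P E e v :
  nth 0 w 0 <= W ->
  (forall u, u < nth 0 w 0 -> ev W (table w P u) [:: u] E (P u)) ->
  ev W (table w P (nth 0 w 0)) [::] e v ->
  runs (program E e) (load w) (W * (time W E + 40) + time W e + 40)
    (fun m => output m = v).
Proof.
set n := nth 0 w 0 => nW HE He.
pose I u (m : memory) := m 2 0 = u /\ forall a i, a < 2 -> m a i = table w P u a i.
apply: (runs_seq (T1 := 3) (T2 := W * (time W E + 40) + time W e + 30) (P := I 0)).
- apply: runs_set_reg => //; split=> // a i a2.
  by rewrite /update (ltn_eqF a2) /= /load /table ltn0 andbF.
- move=> m0 I0.
  apply: (runs_seq (T1 := W * (time W E + 30) + 6) (T2 := time W e + 10) (P := I n)).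
  + apply: (runs_for (N := n) (T := time W E + 22)) I0 _.
    * by move=> j m1 [m2 mt]; rewrite /= mt.
    * move=> u m1 un [m2 mt].
      apply: (runs_seq (T2 := 20) (runs_compile (HE _ un) _ _ _ mt)) => //=.
        by rewrite m2.
      move=> m3 [r3 f3].
      apply: (runs_seq (T1 := 5) (T2 := 10)
        (P := fun m' => m' 2 0 = u /\ forall a i, a < 2 -> m' a i = table w P u.+1 a i)) => //.
        exists (2 + 2).+1, (update m3 1 (eval m3 (reg 2)) (eval m3 (reg 3))).
        split=> //; first exact: exec_put.
        rewrite /= /update /= f3 // r3 m2; split=> // a i a2.
        rewrite f3 ?(leq_trans a2) // mt // /table ltnS (leq_eqVlt i).
        by case: a a2 => [|[|]] //= _; case: (i =P u) => [->|].
      move=> m4 [m42 m4t]; apply: runs_set_reg => //=.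
      rewrite m42 addn1; split=> // a i a2.
      by rewrite /update (ltn_eqF a2) /= m4t.
      by lia.
    * have : n * (time W E + 30) <= W * (time W E + 30) by rewrite leq_mul2r nW orbT.
      have : n * (time W E + 22 + 2 + 4) <= n * (time W E + 30) by rewrite leq_mul2l; lia.
      by rewrite /=; lia.
  + move=> m1 [m2 mt].
    apply: (runs_seq (T2 := 9) (runs_compile He _ _ _ mt)) => //.
      move=> m3 [r3 f3]; apply: runs_set_reg => //=.
    by lia.
  + have : W * (time W E + 30) <= W * (time W E + 40) by rewrite leq_mul2l; lia.
    by nia.
- by lia.
Qed.

Lemma term_computable e f :
  (forall n, exists W, ev W (load [:: n]) [::] e (f n)) -> computable f.
Proof.
move=> H; exists (Seq (compile [::] 2 e) (set_reg 0 (reg 2))) => n.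
have [W He] := H n.
have [t [m [E _ o]]] : runs (Seq (compile [::] 2 e) (set_reg 0 (reg 2)))
    (load [:: n]) (time W e + 10) (fun m => output m = f n).
  apply: (runs_seq (T2 := 9) (runs_compile He _ _ _ (fun _ _ _ => erefl))) => //.
    move=> m1 [r1 _]; apply: runs_set_reg => //=.
  by lia.
by exists t, m.
Qed.

(** * The decision formula *)

(** Truth values are 0 and 1; truncated subtraction provides comparison, negation and
    conjunction. *)
Definition t_le a b := TSub (TConst 1) (TSub a b).
Definition t_not a := TSub (TConst 1) a.
Definition t_and a b := TSub (TAdd a b) (TConst 1).
Definition t_eq a b := t_and (t_le a b) (t_le b a).
(** The loop runs over the second factor, so only that one must be small. [TCall] gives the body a
    closed environment, in which the indices do not depend on the surrounding binders. *)
Definition t_mul a b :=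
  TCall (TFold (TVar 1) (TConst 0) (TAdd (TVar 1) (TVar 2))) a b (TConst 0).
Definition t_if c a b := TAdd (t_mul a c) (t_mul b (t_not c)).
Definition t_sum b e := TFold b (TConst 0) (TAdd (TVar 1) e).
Definition t_div a b :=
  TCall (t_sum (TVar 0) (t_le (t_mul (TVar 3) (TAdd (TVar 0) (TConst 1))) (TVar 2)))
    a b (TConst 0).
Definition t_mod a b :=
  TCall (TSub (TVar 0) (t_mul (TVar 1) (t_div (TVar 0) (TVar 1)))) a b (TConst 0).
Definition t_exp a b :=
  TCall (TFold (TVar 1) (TConst 1) (t_mul (TVar 2) (TVar 1))) a b (TConst 0).

(** * Evaluation rules for the derived operations *)

Section Rules.
Variables (W : nat) (D : memory).
Local Notation ev := (ev W D).

Lemma ev_eq env e v v' : ev env e v -> v = v' -> ev env e v'.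
Proof. by move=> H <-. Qed.

Lemma ev_nth env i v : i < size env -> nth 0 env i = v -> ev env (TVar i) v.
Proof. by move=> H <-; exact: ev_var. Qed.

Lemma ev_le env a b x y : ev env a x -> ev env b y -> ev env (t_le a b) (x <= y).
Proof.
move=> Ha Hb; apply: ev_eq (ev_sub (ev_const _ _ _ 1) (ev_sub Ha Hb)) _.
by lia.
Qed.

Lemma ev_not env a (x : bool) : ev env a x -> ev env (t_not a) (~~ x).
Proof.
by move=> Ha; apply: ev_eq (ev_sub (ev_const _ _ _ 1) Ha) _; case: x {Ha}.
Qed.

Lemma ev_and env a b (x y : bool) :
  ev env a x -> ev env b y -> ev env (t_and a b) (x && y).
Proof.
move=> Ha Hb; apply: ev_eq (ev_sub (ev_add Ha Hb) (ev_const _ _ _ 1)) _.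
by case: x {Ha}; case: y {Hb}.
Qed.

Lemma ev_eqn env a b x y : ev env a x -> ev env b y -> ev env (t_eq a b) (x == y).
Proof.
move=> Ha Hb; apply: ev_eq (ev_and (ev_le Ha Hb) (ev_le Hb Ha)) _.
by rewrite eqn_leq.
Qed.

Lemma ev_mul env a b x y :
  ev env a x -> ev env b y -> y <= W -> ev env (t_mul a b) (x * y).
Proof.
move=> Ha Hb yW; apply: ev_call Ha Hb (ev_const _ _ _ 0) _.
apply: (ev_fold (acc := fun j => x * j)) yW _ _; first exact: ev_nth.
  by rewrite muln0; exact: ev_const.
by move=> j _; rewrite mulnSr; apply: ev_add; exact: ev_nth.
Qed.

Lemma ev_if env c a b (z : bool) x y : 0 < W ->
  ev env c z -> ev env a x -> ev env b y ->
  ev env (t_if c a b) (if z then x else y).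
Proof.
move=> W0 Hc Ha Hb.
apply: ev_eq (ev_add (ev_mul Ha Hc _) (ev_mul Hb (ev_not Hc) _)) _.
- by case: z {Hc}.
- by case: z {Hc}.
by case: z {Hc}; rewrite /= ?muln0 ?muln1 ?addn0.
Qed.

Lemma ev_sum env b e N F :
  ev env b N -> N <= W ->
  (forall j acc, j < N -> ev [:: j, acc & env] e (F j)) ->
  ev env (t_sum b e) (\sum_(0 <= j < N) F j).
Proof.
move=> Hb NW He.
apply: (ev_fold (acc := fun N => \sum_(0 <= j < N) F j)) Hb NW _ _.
  by rewrite big_geq //; exact: ev_const.
move=> j jN; rewrite big_nat_recr //=.
by apply: ev_add; [exact: ev_nth | exact: He].
Qed.

Lemma sum_leq N M : M <= N -> \sum_(0 <= j < N) (j < M : nat) = M.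
Proof.
elim: N M => [|N IH] M; first by rewrite leqn0 => /eqP ->; rewrite big_geq.
rewrite leq_eqVlt ltnS => /orP[/eqP ->|le]; last first.
  by rewrite big_nat_recr //= IH // ltnNge le addn0.
rewrite big_nat_recr //= ltnSn -[RHS]addn1; congr (_ + _).
rewrite -[RHS](IH N) //; apply: eq_big_nat => j /andP[_ jN].
by rewrite jN ltnS ltnW.
Qed.

(** The quotient is the number of [j < x] with [y * (j + 1) <= x], hence a bounded sum. *)
Lemma ev_div env a b x y : 0 < y ->
  ev env a x -> ev env b y -> x < W -> ev env (t_div a b) (x %/ y).
Proof.
move=> y0 Ha Hb xW; apply: ev_call Ha Hb (ev_const _ _ _ 0) _.
rewrite -[v in ev _ _ v](sum_leq (leq_div x y)).
apply: ev_sum; [exact: ev_nth | exact: ltnW | move=> j acc jx].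
rewrite leq_divRL // mulnC -(addn1 j); apply: ev_le; last exact: ev_nth.
apply: ev_mul; first exact: ev_nth; last by lia.
by apply: ev_add; [exact: ev_nth | exact: ev_const].
Qed.

Lemma ev_mod env a b x y : 0 < y ->
  ev env a x -> ev env b y -> x < W -> ev env (t_mod a b) (x %% y).
Proof.
move=> y0 Ha Hb xW; apply: ev_call Ha Hb (ev_const _ _ _ 0) _.
have -> : x %% y = x - y * (x %/ y) by rewrite {2}(divn_eq x y) mulnC addKn.
apply: ev_sub; first exact: ev_nth.
apply: ev_mul; first exact: ev_nth.
  by apply: ev_div => //; exact: ev_nth.
by apply: leq_trans (leq_div _ _) (ltnW xW).
Qed.

Lemma ev_exp env a b x y : 
  ev env a x -> ev env b y -> 0 < x -> y <= W -> x ^ y <= W ->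
  ev env (t_exp a b) (x ^ y).
Proof.
move=> Ha Hb x0 yW eW; apply: ev_call Ha Hb (ev_const _ _ _ 0) _.
apply: (ev_fold (acc := fun j => x ^ j)) yW _ _; first exact: ev_nth.
  by rewrite expn0; exact: ev_const.
move=> j jy; rewrite expnS; apply: ev_mul; try exact: ev_nth.
by apply: leq_trans eW; rewrite leq_pexp2l // ltnW.
Qed.

End Rules.

(** * The formula as a term *)

Local Notation x0 := (TVar 0).
Local Notation x1 := (TVar 1).
Local Notation x2 := (TVar 2).
Local Notation x3 := (TVar 3).
Local Notation x4 := (TVar 4).
Local Notation x5 := (TVar 5).
Local Notation x6 := (TVar 6).
Local Notation cst := TConst.
Local Notation "'call1' f a" := (TCall f a (cst 0) (cst 0)) (at level 10, f, a at level 9).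
Local Notation "'call2' f a b" := (TCall f a b (cst 0)) (at level 10, f, a, b at level 9).
Local Notation call3 := TCall.

Definition t_n := TGet 0 (cst 0).
Definition t_k := TGet 0 (cst 1).
(** The double subtraction computes the minimum of [h] and [n + 1]. *)
Definition t_h := TSub (TGet 0 (cst 2)) (TSub (TGet 0 (cst 2)) (TAdd t_n (cst 1))).
Definition t_adj a b :=
  call2 (TGet 0 (TAdd (cst 3) (TAdd (t_mul x0 t_n) x1))) a b.
Definition t_match a := TGet 1 a.

(* Entry [u] of the table is [v + 1] if [u] is matched to [v < u], and 0 if no
   partner is left; the loop over [v] runs in [:: v; entry so far; u]. *)
Definition t_match_next :=
  TFold x0 (cst 0)
    (t_if (t_and (t_not (t_adj x2 x0))
            (t_and (t_eq (t_match x0) (cst 0))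
              (t_eq (t_sum x2 (t_eq (t_match x0) (TAdd x2 (cst 1)))) (cst 0))))
       (TAdd x0 (cst 1)) x1).

Definition t_in a :=
  call1 (t_not (t_and (t_eq (t_match x0) (cst 0))
    (t_eq (t_sum t_n (t_eq (t_match x0) (TAdd x2 (cst 1)))) (cst 0)))) a.
Definition t_card := t_sum t_n (t_in x0).
Definition t_base := t_mul (TAdd t_card (cst 3)) (TAdd t_card (cst 3)).
Definition t_num_codes := t_exp t_base (TAdd (TAdd t_card t_card) (cst 1)).
Definition t_digit a b :=
  call2 (t_mod (TFold x1 x0 (t_div x1 t_base)) t_base) a b.
Definition t_rank a := call1 (t_sum x0 (t_in x0)) a.
Definition t_lab y u := call2 (t_digit x0 (t_rank x1)) y u.
Definition t_lab_card y i :=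
  call2 (t_sum t_n (t_and (t_in x0) (t_eq (t_lab x2 x0) x3))) y i.
Definition t_blk_of_digit c w :=
  call2 (t_if (t_le x0 (TAdd t_card t_card)) x0
          (t_if (t_le x0 (TAdd (TAdd t_card t_card) (TAdd t_card (cst 1))))
            (TSub t_h (TSub x0 (TAdd (TAdd t_card t_card) (cst 1)))) x1)) c w.
Definition t_blk y w i := call3 (t_blk_of_digit (t_digit x0 (TAdd t_card x2)) x1) y w i.
Definition t_blks y w := call2 (t_sum t_card (t_blk x2 x3 x0)) y w.
Definition t_valid y w :=
  call2 (t_and (t_eq (t_sum t_n (t_and (t_in x0) (t_le t_card (t_lab x2 x0)))) (cst 0))
    (t_and (t_eq (t_sum t_card (t_not (t_and (t_le (t_lab_card x2 x0) (t_blk x2 x3 x0))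
               (t_le (t_blk x2 x3 x0) t_h)))) (cst 0))
        (t_le (t_blks x0 x1) t_n))) y w.
Definition t_nonnbrs y v i :=
  call3 (t_sum t_n (t_and (t_in x0) (t_and (t_eq (t_lab x2 x0) x4)
     (t_not (t_adj x0 x3))))) y v i.
Definition t_price y z v :=
  call3 (t_sum (t_digit x1 t_card)
    (t_eq (t_sum t_card (t_le (TAdd (t_nonnbrs x4 x6 x0) (t_digit x5 x0)) x2)) (cst 0)))
    y z v.
Definition t_dbl a := call1 (TAdd x0 x0) a.
Definition t_pack d :=
  call1 (t_sum x0 (TAdd (t_dbl (t_mod x0 t_h)) (cst 1))) d.
Definition t_edges := t_sum t_n (t_sum t_n (t_adj x2 x0)).
Definition t_inner y :=
  call1 (t_sum t_n (t_sum t_n (t_and (t_and (t_in x2) (t_in x0))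
    (t_and (t_eq (t_lab x4 x2) (t_lab x4 x0)) (t_not (t_adj x2 x0)))))) y.
Definition t_prices y z :=
  call2 (t_sum t_n (t_mul (t_price x2 x3 x0) (t_not (t_in x0)))) y z.
Definition t_sqr a := call1 (t_mul x0 x0) a.
Definition t_rest y w := call2 (TSub t_n (t_blks x0 x1)) y w.
Definition t_income y w z :=
  call3 (TAdd
    (t_sum t_card (t_mul (t_digit x4 x0) (TSub (t_blk x2 x3 x0) (t_lab_card x2 x0))))
    (t_mul (t_digit x2 t_card) (t_rest x0 x1))) y w z.
Definition t_test y w z :=
  call3 (t_le
    (TAdd (TAdd t_edges (t_inner x0)) (TAdd (TSub t_n t_card) (t_dbl (t_prices x0 x2))))
    (TAdd (TAdd (t_dbl t_k) (t_sum t_card (t_sqr (t_blk x2 x3 x0))))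
       (TAdd (t_pack (t_rest x0 x1)) (t_dbl (t_income x0 x1 x2))))) y w z.
Definition t_decide :=
  t_sum t_num_codes (t_sum (TAdd t_n (cst 1))
    (t_and (t_valid x2 x0)
      (t_eq (t_sum t_num_codes (t_not (t_test x4 x2 x0))) (cst 0)))).

(* Number of ordered pairs, diagonal included, within the classes when [d]
   vertices fill classes of size [c] one after the other. *)
Definition packed c d := \sum_(0 <= j < d) (j %% c + j %% c + 1).

(** * The formula as a function on numbers *)

Section Formula.
Variables (n k h : nat) (a : nat -> nat -> bool) (P : nat -> nat).

Definition matched u v := \sum_(0 <= w < u) (P w == v + 1).
(** A vertex is matched if it found a partner below it or was chosen by a later vertex. *)
Definition in_cover u := ~~ ((P u == 0) && (matched n u == 0)).
Definition cover_card := \sum_(0 <= u < n) in_cover u.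
(** Large enough for labels below [s], size codes up to [3 * s + 2] and prices up to [s * (s + 1)].
    Among the [2 * s + 1] digits, [y] holds the labels of the cover in the order of [rank] and then
    the size codes; [z] holds [s + 1] prices. *)
Definition base := (cover_card + 3) * (cover_card + 3).
Definition num_codes := base ^ (cover_card + cover_card + 1).
Definition digit I j := I %/ base ^ j %% base.
Definition rank u := \sum_(0 <= v < u) in_cover v.
Definition lab y u := digit y (rank u).
Definition lab_card y i := \sum_(0 <= u < n) (in_cover u && (lab y u == i)).
Definition cap := h - (h - (n + 1)).
(* The sizes [0 .. 2s] and [cap - s .. cap] are coded by the first [3s + 2]
   digits; any other digit stands for the freely chosen size [w]. *)
Definition blk_of_digit c w :=
  if c <= cover_card + cover_card then c
  else if c <= cover_card + cover_card + (cover_card + 1)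
       then cap - (c - (cover_card + cover_card + 1)) else w.
Definition blk y w i := blk_of_digit (digit y (cover_card + i)) w.
Definition blks y w := \sum_(0 <= i < cover_card) blk y w i.
Definition valid y w :=
  [&& \sum_(0 <= u < n) (in_cover u && (cover_card <= lab y u)) == 0,
      \sum_(0 <= i < cover_card)
        ~~ ((lab_card y i <= blk y w i) && (blk y w i <= cap)) == 0
    & blks y w <= n].
Definition nonnbrs y v i :=
  \sum_(0 <= u < n) (in_cover u && ((lab y u == i) && ~~ a u v)).
(** The minimum of [digit z s] and of all [nonnbrs y v i + digit z i], as the number of thresholds
    below it. The first value is the price of staying outside the blocks, where no vertex of the
    cover is met and the cost is 0. *)
Definition price y z v :=
  \sum_(0 <= t < digit z cover_card)
    (\sum_(0 <= i < cover_card) (nonnbrs y v i + digit z i <= t) == 0).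
Definition pack d := packed cap d.
Definition n_edges := \sum_(0 <= u < n) \sum_(0 <= v < n) a u v.
Definition inner y := \sum_(0 <= u < n) \sum_(0 <= v < n)
  ((in_cover u && in_cover v) && ((lab y u == lab y v) && ~~ a u v)).
Definition prices y z := \sum_(0 <= v < n) price y z v * ~~ in_cover v.
Definition rest y w := n - blks y w.
Definition income y w z :=
  \sum_(0 <= i < cover_card) digit z i * (blk y w i - lab_card y i)
    + digit z cover_card * rest y w.
(** The condition on the cut, with the cost of distributing the clique replaced by its dual value
    [prices - income]; the subtracted term is moved to the other side. *)
Definition test y w z :=
  n_edges + inner y + (n - cover_card + (prices y z + prices y z)) <=
  k + k + \sum_(0 <= i < cover_card) blk y w i * blk y w i
   + (pack (rest y w) + (income y w z + income y w z)).
Definition decide := \sum_(0 <= y < num_codes) \sum_(0 <= w < n + 1)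
  (valid y w && (\sum_(0 <= z < num_codes) ~~ test y w z == 0)).

End Formula.

Section FormulaBounds.
Variables (n h : nat) (P : nat -> nat).

Lemma cover_card_leq : cover_card n P <= n.
Proof.
rewrite /cover_card big_mkord -[leqRHS]card_ord -sum1_card.
by apply: leq_sum => i _; exact: leq_b1.
Qed.

Lemma base_gt2 : 2 < base n P.
Proof. by rewrite /base; lia. Qed.

Lemma base_leq_num_codes : base n P <= num_codes n P.
Proof.
have b0 : 0 < base n P by have := base_gt2; lia.
by rewrite /num_codes addn1 expnS leq_pmulr // expn_gt0 b0.
Qed.

Lemma card3_leq_base : cover_card n P + 3 <= base n P.
Proof. by rewrite /base; lia. Qed.

Lemma digit_lt I j : digit n P I j < base n P.
Proof. by apply: ltn_pmod; have := base_gt2; lia. Qed.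

Lemma rank_leq u : u <= n -> rank n P u <= cover_card n P.
Proof.
move=> un; rewrite /cover_card (big_cat_nat _ (n := u)) //=; exact: leq_addr.
Qed.

Lemma cap_leq : cap n h <= n + 1.
Proof. by rewrite /cap; lia. Qed.

Lemma cap_gt0 : 0 < h -> 0 < cap n h.
Proof. by rewrite /cap; lia. Qed.

End FormulaBounds.

(** * The term evaluates to the formula *)

Section FormulaEval.
Variables (W : nat) (D : memory) (n k h : nat) (a : nat -> nat -> bool).
Variable P : nat -> nat.
Hypotheses (Dn : D 0 0 = n) (Dk : D 0 1 = k) (Dh : D 0 2 = h).
Hypothesis Da : forall u v, u < n -> v < n -> D 0 (3 + (u * n + v)) = a u v.
Local Notation ev := (ev W D).

Lemma ev_n env : ev env t_n n.
Proof. by rewrite -Dn; apply: ev_get => //; exact: ev_const. Qed.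

Lemma ev_k env : ev env t_k k.
Proof. by rewrite -Dk; apply: ev_get => //; exact: ev_const. Qed.

Lemma ev_h env : ev env t_h (cap n h).
Proof.
have H : ev env (TGet 0 (cst 2)) h.
  by rewrite -Dh; apply: ev_get => //; exact: ev_const.
apply: ev_sub => //; apply: ev_sub => //; apply: ev_add; [exact: ev_n|exact: ev_const].
Qed.

Lemma ev_adj env t1 t2 u v : n <= W -> u < n -> v < n ->
  ev env t1 u -> ev env t2 v -> ev env (t_adj t1 t2) (a u v).
Proof.
move=> nW un vn H1 H2; rewrite -Da //; apply: ev_call H1 H2 (ev_const _ _ _ 0) _.
apply: ev_get => //; apply: ev_add; first exact: ev_const.
apply: ev_add; last exact: ev_nth.
apply: ev_mul nW; [exact: ev_nth | exact: ev_n].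
Qed.

(** Vertices are treated in increasing order and choose only smaller ones, so [u] itself is still
    free at its turn; only [v] has to be checked, in both roles. *)
Definition is_partner (Q : nat -> nat) u v :=
  ~~ a u v && ((Q v == 0) && (matched Q u v == 0)).

Fixpoint partner (Q : nat -> nat) u j :=
  if j is i.+1 then if is_partner Q u i then i + 1 else partner Q u i else 0.

Lemma ev_match_next u : 0 < W -> n <= W -> u < n ->
  (forall v, v < u -> D 1 v = P v) ->
  ev [:: u] t_match_next (partner P u u).
Proof.
move=> W0 nW un DP; apply: (ev_fold (acc := partner P u)).
- exact: ev_nth.
- by lia.
- exact: ev_const.
move=> j ju /=; apply: ev_if => //; last exact: ev_nth.
  apply: ev_and.
    by apply: ev_not; apply: ev_adj => //; try exact: ev_nth; lia.
  have Hm e env v : v < u -> ev env e v -> ev env (t_match e) (P v).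
    by move=> vu He; rewrite -DP //; exact: ev_get.
  apply: ev_and; first by apply: ev_eqn; [apply: Hm ju (ev_nth _ _ _ _) | exact: ev_const].
  apply: ev_eqn; last exact: ev_const.
  apply: ev_sum; [exact: ev_nth | by lia |] => w acc wu.
  apply: ev_eqn; first exact: Hm wu (ev_nth _ _ _ _).
  by apply: ev_add; [exact: ev_nth | exact: ev_const].
by apply: ev_add; [exact: ev_nth | exact: ev_const].
Qed.

Hypothesis DP : forall v, v < n -> D 1 v = P v.
Hypothesis h0 : 0 < h.
Let s := cover_card n P.
Let N := num_codes n P.
Hypotheses (nW : n + n + 10 <= W) (NW : N < W).
Let sn : s <= n := cover_card_leq n P.
Let b2 : 2 < base n P := base_gt2 n P.
Let bN : base n P <= N := base_leq_num_codes n P.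
Let s3b : s + 3 <= base n P := card3_leq_base n P.

Lemma W_gt0 : 0 < W. Proof. by lia. Qed.

Lemma ev_in env e u : u < n -> ev env e u -> ev env (t_in e) (in_cover n P u).
Proof.
move=> un He; apply: ev_call He (ev_const _ _ _ 0) (ev_const _ _ _ 0) _.
apply: ev_not; apply: ev_and.
  apply: ev_eqn; last exact: ev_const.
  by rewrite -DP //; apply: ev_get => //; exact: ev_nth.
apply: ev_eqn; last exact: ev_const.
apply: ev_sum; [exact: ev_n | by lia |] => w acc wn.
apply: ev_eqn; first by rewrite -DP //; apply: ev_get => //; exact: ev_nth.
by apply: ev_add; [exact: ev_nth | exact: ev_const].
Qed.

Lemma ev_card env : ev env t_card s.
Proof.
apply: ev_sum; [exact: ev_n | by lia |] => u acc un.
by apply: ev_in => //; exact: ev_nth.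
Qed.

Lemma ev_base env : ev env t_base (base n P).
Proof.
have H : ev env (TAdd t_card (cst 3)) (s + 3).
  by apply: ev_add; [exact: ev_card | exact: ev_const].
by apply: ev_mul => //; lia.
Qed.

Lemma ev_num_codes env : ev env t_num_codes N.
Proof.
apply: ev_exp; [exact: ev_base | | by lia | by rewrite -/s; lia | exact: ltnW].
apply: ev_add (ev_const _ _ _ 1).
by apply: ev_add; exact: ev_card.
Qed.

Lemma ev_digit env e1 e2 I j : I < N -> j <= W ->
  ev env e1 I -> ev env e2 j -> ev env (t_digit e1 e2) (digit n P I j).
Proof.
move=> IN jW H1 H2; have b0 : 0 < base n P by lia.
apply: ev_call H1 H2 (ev_const _ _ _ 0) _.
have IW i : I %/ base n P ^ i < W by have := leq_div I (base n P ^ i); lia.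
apply: ev_mod (ev_base _) _ => //.
apply: (ev_fold (acc := fun i => I %/ base n P ^ i)) jW _ _; first exact: ev_nth.
  by rewrite expn0 divn1; exact: ev_nth.
move=> i ij; rewrite expnSr divnMA; apply: ev_div (ev_base _) _ => //.
exact: ev_nth.
Qed.

Lemma ev_rank env e u : u < n -> ev env e u -> ev env (t_rank e) (rank n P u).
Proof.
move=> un He; apply: ev_call He (ev_const _ _ _ 0) (ev_const _ _ _ 0) _.
apply: ev_sum; [exact: ev_nth | by lia |] => v acc vu.
by apply: ev_in; [lia | exact: ev_nth].
Qed.

Lemma ev_lab env e1 e2 y u : y < N -> u < n ->
  ev env e1 y -> ev env e2 u -> ev env (t_lab e1 e2) (lab n P y u).
Proof.
move=> yN un H1 H2; apply: ev_call H1 H2 (ev_const _ _ _ 0) _.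
have rs := rank_leq P (ltnW un); rewrite -/s in rs.
apply: ev_digit => //; [by lia | exact: ev_nth |].
by apply: ev_rank => //; exact: ev_nth.
Qed.

Lemma ev_lab_card env e1 e2 y i : y < N ->
  ev env e1 y -> ev env e2 i -> ev env (t_lab_card e1 e2) (lab_card n P y i).
Proof.
move=> yN H1 H2; apply: ev_call H1 H2 (ev_const _ _ _ 0) _.
apply: ev_sum; [exact: ev_n | by lia |] => u acc un.
apply: ev_and; first by apply: ev_in => //; exact: ev_nth.
apply: ev_eqn; last exact: ev_nth.
by apply: ev_lab => //; exact: ev_nth.
Qed.

Lemma ev_blk_of_digit env e1 e2 c w :
  ev env e1 c -> ev env e2 w -> ev env (t_blk_of_digit e1 e2) (blk_of_digit n h P c w).
Proof.
move=> H1 H2; apply: ev_call H1 H2 (ev_const _ _ _ 0) _.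
have s2 env' : ev env' (TAdd t_card t_card) (s + s).
  by apply: ev_add; exact: ev_card.
apply: ev_if W_gt0 _ _ _; [by apply: ev_le; [exact: ev_nth | exact: s2] | exact: ev_nth |].
apply: ev_if W_gt0 _ _ _; last exact: ev_nth.
  apply: ev_le; [exact: ev_nth | apply: ev_add; first exact: s2].
  by apply: ev_add; [exact: ev_card | exact: ev_const].
apply: ev_sub; first exact: ev_h.
apply: ev_sub; first exact: ev_nth.
by apply: ev_add; [exact: s2 | exact: ev_const].
Qed.

Lemma blk_leq y w i : w <= n -> blk n h P y w i <= W.
Proof.
move=> wn; rewrite /blk /blk_of_digit -/s.
by have := cap_leq n h; case: ifP; [|case: ifP]; lia.
Qed.

Lemma ev_blk env e1 e2 e3 y w i : y < N -> i < s ->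
  ev env e1 y -> ev env e2 w -> ev env e3 i ->
  ev env (t_blk e1 e2 e3) (blk n h P y w i).
Proof.
move=> yN iS H1 H2 H3; apply: ev_call H1 H2 H3 _.
apply: ev_blk_of_digit; last exact: ev_nth.
apply: ev_digit => //; [by rewrite -/s; lia | exact: ev_nth |].
by apply: ev_add; [exact: ev_card | exact: ev_nth].
Qed.

Lemma ev_blks env e1 e2 y w : y < N ->
  ev env e1 y -> ev env e2 w -> ev env (t_blks e1 e2) (blks n h P y w).
Proof.
move=> yN H1 H2; apply: ev_call H1 H2 (ev_const _ _ _ 0) _.
apply: ev_sum; [exact: ev_card | by rewrite -/s; lia |] => i acc iS.
by apply: ev_blk => //; exact: ev_nth.
Qed.

Lemma ev_valid env e1 e2 y w : y < N ->
  ev env e1 y -> ev env e2 w -> ev env (t_valid e1 e2) (valid n h P y w).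
Proof.
move=> yN H1 H2; apply: ev_call H1 H2 (ev_const _ _ _ 0) _.
apply: ev_and; first apply: ev_eqn (ev_const _ _ _ 0).
  apply: ev_sum; [exact: ev_n | by lia |] => u acc un.
  apply: ev_and; first by apply: ev_in => //; exact: ev_nth.
  by apply: ev_le; [exact: ev_card | apply: ev_lab => //; exact: ev_nth].
apply: ev_and; first apply: ev_eqn (ev_const _ _ _ 0).
  apply: ev_sum; [exact: ev_card | by rewrite -/s; lia |] => i acc iS.
  have Hb : ev [:: i; acc; y; w; 0] (t_blk x2 x3 x0) (blk n h P y w i).
    by apply: ev_blk => //; exact: ev_nth.
  apply: ev_not; apply: ev_and; apply: ev_le => //; last exact: ev_h.
  by apply: ev_lab_card => //; exact: ev_nth.
by apply: ev_le (ev_n _); apply: ev_blks => //; exact: ev_nth.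
Qed.

Lemma ev_nonnbrs env e1 e2 e3 y v i : y < N -> v < n ->
  ev env e1 y -> ev env e2 v -> ev env e3 i ->
  ev env (t_nonnbrs e1 e2 e3) (nonnbrs n a P y v i).
Proof.
move=> yN vn H1 H2 H3; apply: ev_call H1 H2 H3 _.
apply: ev_sum; [exact: ev_n | by lia |] => u acc un.
apply: ev_and; first by apply: ev_in => //; exact: ev_nth.
apply: ev_and.
  by apply: ev_eqn; [apply: ev_lab => //; exact: ev_nth | exact: ev_nth].
by apply: ev_not; apply: ev_adj => //; try exact: ev_nth; lia.
Qed.

Lemma ev_price env e1 e2 e3 y z v : y < N -> z < N -> v < n ->
  ev env e1 y -> ev env e2 z -> ev env e3 v ->
  ev env (t_price e1 e2 e3) (price n a P y z v).
Proof.
move=> yN zN vn H1 H2 H3; apply: ev_call H1 H2 H3 _.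
apply: ev_sum.
- by apply: ev_digit => //; [lia | exact: ev_nth | exact: ev_card].
- by have := digit_lt n P z s; rewrite -/s; lia.
move=> t acc _; apply: ev_eqn (ev_const _ _ _ 0).
apply: ev_sum; [exact: ev_card | by rewrite -/s; lia |] => i acc' iS.
apply: ev_le; last exact: ev_nth.
apply: ev_add; first by apply: ev_nonnbrs => //; exact: ev_nth.
by apply: ev_digit => //; try exact: ev_nth; rewrite -/s in iS; lia.
Qed.

Lemma ev_dbl env e x : ev env e x -> ev env (t_dbl e) (x + x).
Proof.
move=> He; apply: ev_call He (ev_const _ _ _ 0) (ev_const _ _ _ 0) _.
by apply: ev_add; exact: ev_nth.
Qed.

Lemma ev_pack env e d : d <= n -> ev env e d -> ev env (t_pack e) (pack n h d).
Proof.
move=> dn He; apply: ev_call He (ev_const _ _ _ 0) (ev_const _ _ _ 0) _.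
apply: ev_sum; [exact: ev_nth | by lia |] => j acc jd.
apply: ev_add (ev_const _ _ _ 1); apply: ev_dbl.
apply: ev_mod (ev_h _) _; [exact: cap_gt0 | exact: ev_nth | by lia].
Qed.

Lemma ev_edges env : ev env t_edges (n_edges n a).
Proof.
apply: ev_sum; [exact: ev_n | by lia |] => u acc un.
apply: ev_sum; [exact: ev_n | by lia |] => v acc' vn.
by apply: ev_adj => //; try exact: ev_nth; lia.
Qed.

Lemma ev_inner env e y : y < N -> ev env e y -> ev env (t_inner e) (inner n a P y).
Proof.
move=> yN He; apply: ev_call He (ev_const _ _ _ 0) (ev_const _ _ _ 0) _.
apply: ev_sum; [exact: ev_n | by lia |] => u acc un.
apply: ev_sum; [exact: ev_n | by lia |] => v acc' vn.
apply: ev_and; first by apply: ev_and; apply: ev_in => //; exact: ev_nth.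
apply: ev_and; first by apply: ev_eqn; apply: ev_lab => //; exact: ev_nth.
by apply: ev_not; apply: ev_adj => //; try exact: ev_nth; lia.
Qed.

Lemma ev_prices env e1 e2 y z : y < N -> z < N ->
  ev env e1 y -> ev env e2 z -> ev env (t_prices e1 e2) (prices n a P y z).
Proof.
move=> yN zN H1 H2; apply: ev_call H1 H2 (ev_const _ _ _ 0) _.
apply: ev_sum; [exact: ev_n | by lia |] => v acc vn.
apply: ev_mul; last by case: in_cover => /=; lia.
  by apply: ev_price => //; exact: ev_nth.
by apply: ev_not; apply: ev_in => //; exact: ev_nth.
Qed.

Lemma ev_rest env e1 e2 y w : y < N ->
  ev env e1 y -> ev env e2 w -> ev env (t_rest e1 e2) (rest n h P y w).
Proof.
move=> yN H1 H2; apply: ev_call H1 H2 (ev_const _ _ _ 0) _.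
by apply: ev_sub; [exact: ev_n | apply: ev_blks => //; exact: ev_nth].
Qed.

Lemma ev_income env e1 e2 e3 y w z : y < N -> w <= n -> z < N ->
  ev env e1 y -> ev env e2 w -> ev env e3 z ->
  ev env (t_income e1 e2 e3) (income n h P y w z).
Proof.
move=> yN wn zN H1 H2 H3; apply: ev_call H1 H2 H3 _.
apply: ev_add.
  apply: ev_sum; [exact: ev_card | by rewrite -/s; lia |] => i acc iS.
  rewrite -/s in iS.
  apply: ev_mul; last by have := blk_leq y i wn; lia.
    by apply: ev_digit => //; try exact: ev_nth; lia.
  apply: ev_sub; first by apply: ev_blk => //; exact: ev_nth.
  by apply: ev_lab_card => //; exact: ev_nth.
apply: ev_mul; last by rewrite /rest; lia.
  by apply: ev_digit => //; [rewrite -/s; lia | exact: ev_nth | exact: ev_card].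
by apply: ev_rest => //; exact: ev_nth.
Qed.

Lemma ev_test env e1 e2 e3 y w z : y < N -> w <= n -> z < N ->
  ev env e1 y -> ev env e2 w -> ev env e3 z ->
  ev env (t_test e1 e2 e3) (test n k h a P y w z).
Proof.
move=> yN wn zN H1 H2 H3; apply: ev_call H1 H2 H3 _.
apply: ev_le.
  apply: ev_add.
    by apply: ev_add; [exact: ev_edges | apply: ev_inner => //; exact: ev_nth].
  apply: ev_add; first by apply: ev_sub; [exact: ev_n | exact: ev_card].
  by apply: ev_dbl; apply: ev_prices => //; exact: ev_nth.
apply: ev_add.
  apply: ev_add; first by apply: ev_dbl; exact: ev_k.
  apply: ev_sum; [exact: ev_card | by rewrite -/s; lia |] => i acc iS.
  have Hb : ev [:: i; acc; y; w; z] (t_blk x2 x3 x0) (blk n h P y w i).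
    by apply: ev_blk => //; exact: ev_nth.
  apply: ev_call Hb (ev_const _ _ _ 0) (ev_const _ _ _ 0) _.
  by apply: ev_mul; try exact: ev_nth; exact: blk_leq.
apply: ev_add.
  apply: ev_pack; first by rewrite /rest; lia.
  by apply: ev_rest => //; exact: ev_nth.
by apply: ev_dbl; apply: ev_income => //; exact: ev_nth.
Qed.

Lemma ev_decide : ev [::] t_decide (decide n k h a P).
Proof.
apply: ev_sum; [exact: ev_num_codes | exact: ltnW |] => y acc yN.
apply: ev_sum; [| by lia |].
  by apply: ev_add; [exact: ev_n | exact: ev_const].
move=> w acc'; rewrite addn1 ltnS => wn.
apply: ev_and; first by apply: ev_valid => //; exact: ev_nth.
apply: ev_eqn (ev_const _ _ _ 0).
apply: ev_sum; [exact: ev_num_codes | exact: ltnW |] => z acc'' zN.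
by apply: ev_not; apply: ev_test => //; exact: ev_nth.
Qed.

End FormulaEval.

(** * Prices for the transportation problem *)

(** [T] may be infinite and [A] undecidable, as for labellings and routes below, so the ascent to a
    maximum is classical. *)
Lemma ex_maximal (T : Type) (A : T -> Prop) (f : T -> nat) b :
  (exists x, A x) -> (forall x, A x -> f x <= b) ->
  exists2 x, A x & forall y, A y -> f y <= f x.
Proof.
move=> [x Ax] fb.
have [r] : exists r, b - f x <= r by exists (b - f x).
elim: r x Ax => [|r IH] x Ax xr; first by exists x => // y /fb; lia.
have [[y [Ay fxy]]|no] := classic (exists y, A y /\ f x < f y).
  by apply: (IH y) => //; have := fb _ Ay; lia.
exists x => // y Ay; rewrite leqNgt; apply/negP => fxy.
by apply: no; exists y.
Qed.

Lemma choice_below (T : Type) (x : T) (Q : nat -> T -> Prop) m :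
  (forall i, i < m -> exists y, Q i y) ->
  exists f : nat -> T, forall i, i < m -> Q i (f i).
Proof.
elim: m => [|m IH] H; first by exists (fun=> x).
have [|f Hf] := IH; first by move=> i im; apply: H; lia.
have [y Qy] := H m (ltnSn m).
exists (fun i => if i == m then y else f i) => i.
by rewrite ltnS leq_eqVlt; case: eqP => [->|_] //=; exact: Hf.
Qed.

Section Prices.
Variables (T : finType) (K : {set T}) (p s : nat) (c : T -> nat -> nat).
Variable g : T -> nat.
Hypothesis gp : forall v, v \in K -> g v < p.
Hypothesis cs : forall v j, v \in K -> j < p -> c v j <= s.
Hypothesis gopt : forall g' : T -> nat, (forall v, v \in K -> g' v < p) ->
  (forall j, #|[set v in K | g' v == j]| = #|[set v in K | g v == j]|) ->
  \sum_(v in K) c v (g v) <= \sum_(v in K) c v (g' v).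

Definition stay_cost (q : seq T) := \sum_(v <- q) c v (g v).

Definition next_label (q : seq T) j := if q is u :: _ then g u else j.

(** Every vertex of [q] moves to the label of its successor, the last one
    to [j]. *)
Fixpoint shift_cost (q : seq T) j :=
  if q is v :: q' then c v (next_label q' j) + shift_cost q' j else 0.

Lemma shift_cost_cat q1 q2 j :
  shift_cost (q1 ++ q2) j = shift_cost q1 (next_label q2 j) + shift_cost q2 j.
Proof.
elim: q1 => [|v q1 IH] //=; rewrite IH addnA; congr (_ + _ + _).
by case: q1 {IH}.
Qed.

Lemma shift_cost_next_at u0 u q : uniq (u :: q) ->
  shift_cost (u :: q) (g u0) = \sum_(v <- u :: q) c v (g (next_at v u0 u q)).
Proof.
elim: q u => [|w q IH] u /=; first by rewrite big_seq1 eqxx addn0.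
move=> /andP[uwq uq]; rewrite big_cons /= eqxx; congr (_ + _).
rewrite [LHS](IH w uq) !big_seq; apply: eq_bigr => v vin /=.
by case: eqP uwq vin => // -> /negP.
Qed.

(** Rotating the labels along the cycle permutes [K] and keeps all class sizes, so optimality of [g]
    excludes any gain. *)
Lemma cycle_cost u q : uniq (u :: q) -> {subset u :: q <= K} ->
  stay_cost (u :: q) <= shift_cost (u :: q) (g u).
Proof.
move=> uq qK; rewrite shift_cost_next_at //.
pose nx := next (u :: q).
have nxK v : (nx v \in K) = (v \in K).
  have [vq|vq] := boolP (v \in u :: q); last first.
    rewrite /nx next_nth (negbTE vq) //.
  by rewrite (qK _ vq) qK // mem_next.
have opt : \sum_(v in K) c v (g v) <= \sum_(v in K) c v (g (nx v)).
  apply: (gopt (g' := g \o nx)) => [v vK|j]; first by apply: gp; rewrite nxK.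
  have <- := card_preimset [set v in K | g v == j] (can_inj (prev_next uq)).
  by congr #|pred_of_set _|; apply/setP=> v; rewrite !inE -/nx nxK.
have fixed : \sum_(v in K | v \notin u :: q) c v (g (nx v)) =
             \sum_(v in K | v \notin u :: q) c v (g v).
  by apply: eq_bigr => v /andP[_ vq]; rewrite /nx next_nth (negbTE vq).
have inq F : \sum_(v in K | v \in u :: q) F v = \sum_(v <- u :: q) F v :> nat.
  rewrite big_uniq //=; apply: eq_bigl => v; rewrite andbC.
  by case: (boolP (v \in u :: q)) => //= /qK.
move: opt; rewrite (bigID (mem (u :: q))) [leqRHS](bigID (mem (u :: q))) /=.
by rewrite fixed leq_add2r !inq.
Qed.

(** A simple path in the graph of labels, ending at [j]. Since no label repeats, it has at most [p]
    vertices and gains at most [p * s]. *)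
Definition route (q : seq T) j :=
  [/\ {subset q <= K}, uniq (map g q) & j \notin map g q].

Lemma route_size q j : route q j -> size q <= p.
Proof.
move=> [qK uq _]; rewrite -(size_map g) -(size_iota 0 p).
apply: uniq_leq_size => // _ /mapP[v vq ->].
by rewrite mem_iota /= add0n gp ?qK.
Qed.

Lemma stay_cost_leq q : {subset q <= K} -> stay_cost q <= size q * s.
Proof.
rewrite /stay_cost; elim: q => [|v q IH] qK; first by rewrite big_nil.
rewrite big_cons mulSn leq_add //.
  by apply: cs; rewrite ?gp ?qK ?mem_head.
by apply: IH => w wq; rewrite qK // inE wq orbT.
Qed.

Lemma route_cost q j : route q j -> stay_cost q <= p * s.
Proof.
move=> rq; have [qK _ _] := rq.
exact: leq_trans (stay_cost_leq qK) (leq_mul (route_size rq) (leqnn s)).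
Qed.

(* The price of [j] is the largest gain of shifting vertices along a route
   that ends at [j]. *)
Lemma exists_prices : exists pi : nat -> nat,
  (forall j, j < p -> pi j <= p * s) /\
  (forall v j, v \in K -> j < p -> c v (g v) + pi (g v) <= c v j + pi j).
Proof.
have gain j : exists2 q, route q j &
    forall q', route q' j ->
      stay_cost q' - shift_cost q' j <= stay_cost q - shift_cost q j.
  apply: (@ex_maximal _ _ _ (p * s)); first by exists [::]; split.
  by move=> q /route_cost; exact: leq_trans (leq_subr _ _).
pose Q j x := exists2 q, route q j /\ x = stay_cost q - shift_cost q j &
    forall q', route q' j -> stay_cost q' <= x + shift_cost q' j.
have [|pi Hpi] := @choice_below nat 0 Q p.
  move=> j _; have [q rq qmax] := gain j; exists (stay_cost q - shift_cost q j).
  by exists q => // q' /qmax; lia.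
exists pi; split=> [j jp|v j vK jp].
  have [q [/route_cost rq ->] _] := Hpi j jp.
  exact: leq_trans (leq_subr _ _) rq.
have [q [rq piq] _] := Hpi _ (gp vK); have [_ _ qmax] := Hpi j jp.
have [<-//|gj] := eqVneq (g v) j.
(* Positivity makes the truncated difference that defines [pi (g v)] exact. *)
have [pi0|pi_gt0] := posnP (pi (g v)).
  have := qmax [:: v]; rewrite /stay_cost big_seq1 /= pi0 addn0; move=> H.
  have : route [:: v] j.
    by split=> //= [w|]; rewrite inE; [move/eqP-> | rewrite eq_sym].
  by move/H; lia.
have [qK uq gvq] := rq.
(* If [q] avoids the label [j], appending [v] gives a route to [j]. Otherwise [q] is cut at the
   vertex [u] labelled [j]: the part before [u] is a route to [j], and the part from [u] on closes
   up with [v] into a cycle, which gains nothing. *)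
have [jq|jq] := boolP (j \in map g q); last first.
  have rqv : route (rcons q v) j.
    split; rewrite ?map_rcons ?rcons_uniq ?gvq //.
      by move=> w; rewrite mem_rcons inE => /predU1P[->|/qK].
    by rewrite mem_rcons inE negb_or eq_sym gj.
  have := qmax _ rqv.
  by rewrite -cats1 shift_cost_cat /stay_cost big_cat /= !big_seq1 -/(stay_cost q); lia.
have [u uinq gu] := mapP jq; case/splitPr: uinq qK uq gvq piq rq jq => q1 q2 qK uq gvq piq rq jq.
have uq1 : uniq (map g q1) /\ j \notin map g q1.
  move: uq; rewrite map_cat cat_uniq /= -gu => /and3P[-> /norP[-> _] _]; by [].
have r1 : route q1 j.
  by case: uq1; split=> // w wq; apply: qK; rewrite mem_cat wq.
have cyc : stay_cost (u :: rcons q2 v) <= shift_cost (u :: rcons q2 v) (g u).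
  apply: cycle_cost.
    apply: (@map_uniq _ _ g); rewrite -rcons_cons map_rcons rcons_uniq.
    move: uq gvq; rewrite map_cat cat_uniq mem_cat => /and3P[_ _ ->].
    by rewrite negb_or => /andP[_ ->].
  move=> w; rewrite -rcons_cons mem_rcons inE => /predU1P[->//|wq].
  by apply: qK; rewrite mem_cat wq orbT.
have := qmax _ r1; move: cyc piq.
rewrite -rcons_cons -cats1 !shift_cost_cat /stay_cost !big_cat /= -gu.
rewrite !big_seq1 -/(stay_cost q1).
by set a1 := stay_cost q1; set a2 := \sum_(_ <- u :: q2) _; lia.
Qed.

End Prices.

(** The enumeration of [K] is labelled in order by a list with [a i] copies of each [i]. *)
Lemma exists_assignment (T : finType) (K : {set T}) p (a : nat -> nat) :
  \sum_(0 <= i < p) a i = #|K| ->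
  exists g : T -> nat, (forall v, v \in K -> g v < p) /\
    (forall j, j < p -> #|[set v in K | g v == j]| = a j).
Proof.
move=> sumK; pose l := flatten [seq nseq (a i) i | i <- iota 0 p].
have cl j : j < p -> count_mem j l = a j.
  move=> jp; rewrite count_flatten -map_comp.
  rewrite (eq_map (g := fun i => (i == j) * a i)); last first.
    by move=> i /=; rewrite count_nseq /= .
  rewrite sumnE big_map (bigD1_seq j) ?iota_uniq //=; last by rewrite mem_iota.
  by rewrite eqxx mul1n big1 ?addn0 // => i /negbTE ->.
have sl : size l = #|K|.
  rewrite size_flatten /shape -map_comp sumnE big_map -sumK /index_iota subn0.
  by apply: eq_bigr => i _ /=; rewrite size_nseq.
exists (fun v => nth 0 l (index v (enum K))); split=> [v vK|j jp].
  have /flattenP[_ /mapP[i ip ->]] : nth 0 l (index v (enum K)) \in l.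
    by apply: mem_nth; rewrite sl cardE index_mem mem_enum.
  by rewrite mem_nseq => /andP[_ /eqP ->]; rewrite mem_iota in ip.
rewrite -(cl j jp).
have lE : l = [seq nth 0 l (index v (enum K)) | v <- enum K].
  apply: (@eq_from_nth _ 0); first by rewrite size_map -cardE.
  move=> i; rewrite sl cardE => iK.
  have [y0 _] : exists x, x \in K.
    by apply/set0Pn; rewrite -card_gt0 cardE; lia.
  by rewrite (nth_map y0) // index_uniq // enum_uniq.
rewrite [in RHS]lE -sum1_count big_map -sum1_card big_enum_cond /=.
by apply: eq_bigl => v; rewrite !inE.
Qed.

(** * Labellings *)

(** Each vertex contributes the difference of two consecutive squares. The case [r = c] is included
    because the induction on [q] starts the next class from it. *)
Lemma packedE c q r : r <= c -> packed c (q * c + r) = q * c ^ 2 + r ^ 2.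
Proof.
elim: q r => [|q IHq] r.
  elim: r => [|r IHr] rc; first by rewrite /packed big_geq.
  rewrite mul0n add0n /packed big_nat_recr //= -/(packed c r).
  move: (IHr (ltnW rc)); rewrite !mul0n !add0n => ->.
  by rewrite modn_small //; lia.
elim: r => [|r IHr] rc.
  by rewrite addn0 mulSn addnC IHq //; lia.
rewrite addnS /packed big_nat_recr //= -/(packed c (q.+1 * c + r)) (IHr (ltnW rc)).
by rewrite modnMDl modn_small //; lia.
Qed.

(** Convexity of squares: topping up the partial class with [b] vertices yields at least as many
    pairs as a separate class for them. *)
Lemma packed_add c d b : 0 < c -> b <= c -> b ^ 2 + packed c d <= packed c (d + b).
Proof.
move=> c0 bc; have rc := ltn_pmod d c0; rewrite (divn_eq d c).
move: (d %/ c) (d %% c) rc => q r rc; rewrite packedE ?(ltnW rc) //.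
have [le|lt] := leqP (r + b) c; first by rewrite -addnA packedE //; nia.
have -> : q * c + r + b = q.+1 * c + (r + b - c) by lia.
rewrite packedE; last by lia.
have [m Em] : exists m, r + b = c + m by exists (r + b - c); lia.
have -> : r + b - c = m by lia.
by nia.
Qed.

(** Packing into full classes is optimal: the classes of [f] are removed one at a time, each paid
    for by [packed_add]. *)
Lemma sum_clusters_leq (T : finType) (f : T -> nat) c (D : {set T}) : 0 < c ->
  (forall i, #|[set v in D | f v == i]| <= c) ->
  \sum_(u in D) #|[set v in D | f v == f u]| <= packed c #|D|.
Proof.
move=> c0; have [m] := ubnP #|D|; elim: m D => // m IH D Dm fc.
have [->|[u uD]] := set_0Vmem D; first by rewrite big_set0.
pose C := [set v in D | f v == f u].
have uC : u \in C by rewrite inE uD /=.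
have CD : C \subset D by apply/subsetP=> v; rewrite inE => /andP[].
have cardD : #|D| = #|D :\: C| + #|C|.
  by rewrite -(cardsID C D) addnC; congr (_ + _); rewrite (setIidPr CD).
have C0 : 0 < #|C| by apply/card_gt0P; exists u.
rewrite (bigID (mem C)) /= [X in X + _](_ : _ = #|C| ^ 2); last first.
  rewrite -mulnn -sum_nat_const; apply: eq_big => v; rewrite inE andbA andbb //.
  by move=> /andP[_ /eqP ->].
have DC v : (v \in D) && (v \notin C) = (v \in D :\: C) by rewrite in_setD andbC.
rewrite (eq_bigl _ _ DC) cardD.
apply: leq_trans (packed_add _ c0 (fc (f u))); rewrite leq_add2l.
rewrite (eq_bigr (fun w => #|[set v in D :\: C | f v == f w]|)); last first.
  move=> w; rewrite !inE => /andP[wC wD]; apply: eq_card => v; rewrite !inE.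
  case: (boolP (v \in D)) => vD; rewrite ?andbF //=.
  rewrite wD /= in wC; case: (f v =P f w) => [->|]; last by rewrite andbF.
  by rewrite wC.
apply: IH; first by lia.
move=> i; apply: leq_trans (fc i); apply: subset_leq_card.
by apply/subsetP=> v; rewrite !inE => /andP[/andP[_ ->]].
Qed.

Section SymSum.
Variables (n : nat) (b : rel 'I_n).
Hypotheses (b_sym : symmetric b) (b_irr : irreflexive b).

Lemma sum_sym :
  \sum_u \sum_v (b u v : nat) =
  2 * #|[set p : 'I_n * 'I_n | (p.1 < p.2) && b p.1 p.2]|.
Proof.
rewrite pair_big /= (bigID (fun p : 'I_n * 'I_n => p.1 < p.2)) /=.
have up : \sum_(p : 'I_n * 'I_n | p.1 < p.2) (b p.1 p.2 : nat) =
    #|[set p : 'I_n * 'I_n | (p.1 < p.2) && b p.1 p.2]|.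
  rewrite -sum1_card big_mkcond [RHS]big_mkcond; apply: eq_bigr => p _.
  by rewrite inE; case: ltnP; case: b.
rewrite up mul2n -addnn; congr (_ + _).
rewrite -up (reindex_inj (h := fun p => (p.2, p.1))) /=; last first.
  by move=> [u v] [u' v'] [-> ->].
rewrite big_mkcond [RHS]big_mkcond; apply: eq_bigr => -[u v] _ /=.
rewrite b_sym -leqNgt leq_eqVlt; case: (ltnP u v) => [_|]; first by rewrite orbT.
by rewrite orbF; case: eqP => // /ord_inj ->; rewrite b_irr.
Qed.
End SymSum.

(** A solution is labelled by the roots of its components. Conversely all edges between different
    labels are deleted, and each label class is closed under the remaining ones. Each edge is two
    ordered pairs, hence [2 * budget x]. *)
Lemma labelled_iff (x : instance) :
  tree_free_edge_deletion x <->
  exists g : 'I_(num_verts (graph x)) -> nat,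
    (forall i, #|[set v | g v == i]| <= bound x) /\
    \sum_u \sum_v (@adj (graph x) u v && (g u != g v)) <= 2 * budget x.
Proof.
set G := graph x; have asym := @adj_sym G; have airr := @adj_irr G.
pose cut (g : 'I_(num_verts G) -> nat) u v := adj u v && (g u != g v).
have cut_sym g : symmetric (cut g) by move=> u v; rewrite /cut asym eq_sym.
have cut_irr g : irreflexive (cut g) by move=> u; rewrite /cut airr.
have sumE g := sum_sym (cut_sym g) (cut_irr g).
split=> [[F [FE Fk Fh]]|[g [gh gk]]].
  pose e := adj_del F.
  have esym : symmetric e by move=> u v; rewrite /e /adj_del asym setUC.
  have csym : connect_sym e by exact: sym_connect_sym.
  pose g (v : 'I_(num_verts G)) : nat := (root e v : 'I_(num_verts G)).
  have gE u v : (g u == g v) = connect e u v.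
    by rewrite -(root_connect csym) /g (inj_eq val_inj).
  exists g; split=> [i|].
    have [v0 /eqP v0i|none] := pickP (fun v => g v == i); last first.
      by rewrite (_ : [set v | _] = set0) ?cards0 //; apply/setP=> v; rewrite !inE none.
    apply: leq_trans (Fh [set y in [set: _] | connect e v0 y] _); last first.
      by apply/imsetP; exists v0.
    apply: subset_leq_card; apply/subsetP=> v; rewrite !inE /= => vi.
    by rewrite -gE v0i eq_sym.
  rewrite (sumE g) leq_mul2l /=; apply: leq_trans Fk.
  rewrite -(card_in_imset (f := fun p => [set p.1; p.2])).
    apply: subset_leq_card; apply/subsetP=> _ /imsetP[[u v] + ->].
    rewrite inE /= => /and3P[uv auv guv]; apply: contraR guv => uvF.
    by rewrite gE connect1 // /e /adj_del auv.
  move=> [u v] [u' v'] /=; rewrite !inE /= => /andP[uv _] /andP[uv' _] E.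
  have : u \in [set u'; v'] by rewrite -E set21.
  have : v \in [set u'; v'] by rewrite -E set22.
  rewrite !inE => /orP[]/eqP Ev /orP[]/eqP Eu; subst => //.
  - by rewrite ltnn in uv.
  - by have := ltn_trans uv uv'; rewrite ltnn.
  - by rewrite ltnn in uv.
pose A := [set p : 'I_(num_verts G) * 'I_(num_verts G) | (p.1 < p.2) && cut g p.1 p.2].
exists [set [set p.1; p.2] | p in A]; split.
- apply/subsetP=> _ /imsetP[[u v] + ->]; rewrite !inE /= => /and3P[_ auv _].
  by apply/existsP; exists u; apply/existsP; exists v; rewrite auv /=.
- apply: leq_trans (leq_imset_card _ _) _.
  by move: gk; rewrite sumE leq_mul2l.
move=> _ /imsetP[u _ ->]; apply: leq_trans (gh (g u)).
apply: subset_leq_card; apply/subsetP=> v; rewrite !inE /= => cuv.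
set e := adj_del _ in cuv.
have : closed e [pred w | g w == g u].
  apply: intro_closed => [|w z /andP[awz]]; last first.
    rewrite !inE => + /eqP gw; apply: contraR; rewrite -gw => gwz.
    have cwz : cut g w z by rewrite /cut awz eq_sym gwz.
    apply/imsetP; have [wz|zw|/ord_inj E] := ltngtP w z.
    + by exists (w, z) => //; rewrite inE /= wz.
    + by exists (z, w); [rewrite inE /= zw cut_sym | rewrite setUC].
    + by rewrite E airr in awz.
  by apply: sym_connect_sym => w z; rewrite /e /adj_del asym setUC.
by move/closed_connect => /(_ _ _ cuv); rewrite !inE eqxx => <-.
Qed.

(** * Blocks *)

Lemma sum_divn_eq h q d : 0 < h ->
  \sum_(0 <= j < d) (j %/ h == q) = minn (d - q * h) h.
Proof.
move=> h0; elim: d => [|d IH]; first by rewrite big_geq //; lia.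
rewrite big_nat_recr //= IH eqn_leq -ltnS ltn_divLR // leq_divRL //.
by rewrite mulSn; case: leqP; case: leqP; lia.
Qed.

(** Cutting [d] positions into intervals of length [h] attains the bound of [sum_clusters_leq]. *)
Lemma sum_same_block h d : 0 < h ->
  \sum_(0 <= i < d) \sum_(0 <= j < d) (j %/ h == i %/ h) = packed h d.
Proof.
move=> h0; have md : minn (d - d %/ h * h) h = d %% h by have := ltn_pmod d h0; lia.
elim: d {md} => [|d IH]; first by rewrite /packed !big_geq.
have md : minn (d - d %/ h * h) h = d %% h.
  by have := ltn_pmod d h0; have := divn_eq d h; lia.
rewrite big_nat_recr //= [X in _ + X]big_nat_recr //= sum_divn_eq // md eqxx.
rewrite (eq_bigr (fun i => \sum_(0 <= j < d) (j %/ h == i %/ h) + (i %/ h == d %/ h))).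
  rewrite big_split /= IH sum_divn_eq // md.
  by rewrite /packed big_nat_recr //= -!addnA.
by move=> i _; rewrite big_nat_recr //= [d %/ h == _]eq_sym.
Qed.

Lemma sum_index_enum (T : finType) (D : {set T}) (F : nat -> nat) :
  \sum_(u in D) F (index u (enum D)) = \sum_(0 <= i < #|D|) F i.
Proof.
rewrite -big_enum /= /index_iota subn0 cardE.
rewrite -(big_map (fun u => index u (enum D)) predT F) /=.
congr (\sum_(i <- _) _); have := enum_uniq D; move: (enum D) => l ul.
apply: (@eq_from_nth _ 0); rewrite size_map ?size_iota // => i il.
case: l ul il => // x l ul il.
by rewrite (nth_map x) // index_uniq // nth_iota.
Qed.

Lemma sum_labels_in (T : finType) (g : T -> nat) (S : {set T}) s (F : nat -> nat) :
  \sum_(u in S | g u < s) F (g u) =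
  \sum_(0 <= i < s) #|[set v in S | g v == i]| * F i.
Proof.
elim: s => [|s IH]; first by rewrite big_geq // big_pred0 // => u; rewrite andbF.
rewrite big_nat_recr //= -IH (bigID (fun u => g u < s)) /=; congr (_ + _).
  by apply: eq_bigl => u; rewrite -andbA; congr (_ && _); lia.
rewrite -sum_nat_const; apply: eq_big => u; last by move=> H; congr F; lia.
by rewrite !inE -andbA; congr (_ && _); lia.
Qed.

Definition cls (T : finType) (g : T -> nat) i := #|[set v | g v == i]|.

Lemma sum_labels_lt (T : finType) (g : T -> nat) s (F : nat -> nat) :
  \sum_(u | g u < s) F (g u) = \sum_(0 <= i < s) cls g i * F i.
Proof.
transitivity (\sum_(u in [set: T] | g u < s) F (g u)).
  by apply: eq_bigl => u; rewrite inE.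
rewrite sum_labels_in; apply: eq_bigr => i _; congr (_ * _).
by apply: eq_card => v; rewrite !inE.
Qed.

Section Blocks.
Variables (T : finType) (a : rel T) (X : {set T}).
Hypotheses (a_sym : symmetric a) (a_irr : irreflexive a).
Hypothesis clique : forall u v, u \notin X -> v \notin X -> u != v -> a u v.

(* Pairs are ordered and include the diagonal, where [a] is false. *)
Definition same_nonadj (g : T -> nat) := \sum_u \sum_v ((g u == g v) && ~~ a u v).
Definition cover_nonadj (g : T -> nat) :=
  \sum_(u in X) \sum_(v in X) ((g u == g v) && ~~ a u v).
Definition nonadj_to (g : T -> nat) v i := \sum_(u in X) ((g u == i) && ~~ a u v).
Definition clique_nonadj (g : T -> nat) := \sum_(v in ~: X) nonadj_to g v (g v).

(** Inside the clique only the diagonal pairs are nonadjacent, one per vertex; pairs between [X] and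
    the clique occur in both orders. *)
Lemma same_nonadjE g : same_nonadj g =
  cover_nonadj g + (#|~: X| + (clique_nonadj g + clique_nonadj g)).
Proof.
have F_sym u v : ((g u == g v) && ~~ a u v) = ((g v == g u) && ~~ a v u).
  by rewrite eq_sym a_sym.
have inC v : (v \in ~: X) = (v \notin X) by rewrite inE.
rewrite /same_nonadj (bigID (mem X)) /=.
rewrite (eq_bigr (fun u => \sum_(v in X) ((g u == g v) && ~~ a u v) +
     \sum_(v in ~: X) ((g u == g v) && ~~ a u v))); last first.
  by move=> u _; rewrite (bigID (mem X)) /=; congr (_ + _); apply: eq_bigl.
rewrite big_split /= -addnA; congr (_ + _).
rewrite exchange_big /= [RHS]addnCA; congr (_ + _).
rewrite (eq_bigr (fun u => nonadj_to g u (g u) + 1)); last first.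
  move=> u uX; rewrite (bigID (mem X)) /=; congr (_ + _).
    by apply: eq_bigr => v _; rewrite F_sym.
  rewrite (bigD1 u) //= eqxx a_irr big1 // => v /andP[vX vu].
  by rewrite clique ?andbF // eq_sym.
rewrite big_split /= sum1_card addnC; congr (_ + _); first exact: eq_card.
by apply: eq_bigl => u; rewrite inE.
Qed.

(** An identity for each ordered pair. The second sum on the left is the sum of the squared class
    sizes. *)
Lemma sum_cut g :
  \sum_u \sum_v (a u v && (g u != g v)) + \sum_u cls g (g u) =
  \sum_u \sum_v (a u v : nat) + same_nonadj g.
Proof.
rewrite /same_nonadj -!big_split; apply: eq_bigr => u _ /=.
rewrite /cls -sum1_card [X in _ + X]big_mkcond -!big_split /=.
apply: eq_bigr => v _; rewrite inE eq_sym.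
by case: (a u v); case: (g v == g u).
Qed.

Variables (h k : nat).
Hypothesis h0 : 0 < h.
Let s := #|X|.

(** Label [s] merges all classes that avoid [X], so its size is not bounded by [h]. *)
Definition blocks (g : T -> nat) :=
  [/\ forall v, v \in X -> g v < s, forall v, g v <= s
    & forall i, i < s -> cls g i <= h].

(** The bound on the cut after [sum_cut] and [same_nonadjE], with the vertices labelled [s] packed
    optimally. *)
Definition fits (g : T -> nat) :=
  \sum_u \sum_v (a u v : nat) + cover_nonadj g +
    (#|~: X| + (clique_nonadj g + clique_nonadj g))
  <= k + k + \sum_(0 <= i < s) cls g i * cls g i + packed h (cls g s).

Lemma nonadj_eq g g' :
  (forall u v, u \in X -> (g' u == g' v) = (g u == g v)) ->
  cover_nonadj g' = cover_nonadj g /\ clique_nonadj g' = clique_nonadj g.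
Proof.
move=> H; split.
  by apply: eq_bigr => u uX; apply: eq_bigr => v _; rewrite H.
by apply: eq_bigr => v _; apply: eq_bigr => u uX; rewrite H.
Qed.

(** Labels used on [X] are renumbered by their position in [L], all others become [s]. No agreement
    with a vertex of [X] changes, and [sum_clusters_leq] bounds the pairs inside the merged
    classes. *)
Lemma blocks_of_labels g :
  (forall i, cls g i <= h) ->
  \sum_u \sum_v (a u v && (g u != g v)) <= 2 * k ->
  exists2 g', blocks g' & fits g'.
Proof.
move=> gh gk; pose L := undup [seq g u | u <- enum X].
have Ls : size L <= s.
  by rewrite /s cardE -(size_map g); exact: size_undup.
have LX u : u \in X -> g u \in L.
  by move=> uX; rewrite mem_undup map_f // mem_enum.
pose g' v := if g v \in L then index (g v) L else s.
have g'E u v : g u \in L -> (g' v == g' u) = (g v == g u).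
  move=> uL; rewrite /g' uL; case: ifP => vL.
    apply/eqP/eqP => [E|->//].
    by rewrite -(nth_index 0 uL) -E nth_index.
  rewrite -index_mem in uL; rewrite gtn_eqF ?(leq_trans uL) //.
  by apply/esym/negbTE; apply: contraFN vL => /eqP ->; rewrite -index_mem.
have g's v : (g' v < s) = (g v \in L).
  by rewrite /g'; case: ifP; rewrite ?ltnn // -index_mem => /leq_trans ->.
exists g'.
  split=> [v /LX|v|i iS]; first by rewrite g's.
    by rewrite leq_eqVlt g's /g'; case: ifP; rewrite ?eqxx ?orbT.
  have [u /eqP ui|none] := pickP (fun u => g' u == i); last first.
    by rewrite /cls (_ : [set v | _] = set0) ?cards0 //; apply/setP=> v; rewrite !inE none.
  have uL : g u \in L by rewrite -g's ui.
  apply: leq_trans (gh (g u)); rewrite /cls; apply: subset_leq_card.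
  by apply/subsetP=> v; rewrite !inE -ui g'E.
have [E1 E2] : cover_nonadj g' = cover_nonadj g /\ clique_nonadj g' = clique_nonadj g.
  by apply: nonadj_eq => u v /LX uL; rewrite eq_sym g'E // eq_sym.
rewrite /fits E1 E2 -addnA -same_nonadjE -sum_cut -addnA leq_add //; first by lia.
rewrite (bigID (fun u => g u \in L)) /= leq_add //.
  rewrite -(sum_labels_lt g' s (cls g')).
  rewrite (eq_bigl (fun u => g' u < s)); last by move=> u; rewrite g's.
  apply: leq_sum => u; rewrite g's => uL; rewrite /cls; apply: subset_leq_card.
  by apply/subsetP=> v; rewrite !inE g'E.
rewrite /cls; set D := [set v | g' v == s].
have DE v : (v \in D) = (g v \notin L).
  by rewrite inE /g'; case: ifP; rewrite ?eqxx // -index_mem; lia.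
rewrite (eq_bigl _ _ (fun v => esym (DE v))).
apply: leq_trans (sum_clusters_leq (f := g) h0 _); last first.
  move=> i; apply: leq_trans (gh i); apply: subset_leq_card.
  by apply/subsetP=> v; rewrite !inE => /andP[].
apply: leq_sum => u uD; apply: subset_leq_card; apply/subsetP=> v.
by rewrite inE => vu; apply/setIdP; split=> //; rewrite DE (eqP vu) -DE.
Qed.

(** The last class is cut along its enumeration into intervals of length [h], which receive the
    labels from [s] on. *)
Lemma labels_of_blocks g : blocks g -> fits g ->
  exists2 g' : T -> nat, (forall i, cls g' i <= h) &
    \sum_u \sum_v (a u v && (g' u != g' v)) <= 2 * k.
Proof.
move=> [gX gs gh] fg; pose D := [set v | g v == s].
pose ix v := index v (enum D) %/ h.
pose g' v := if g v < s then g v else s + ix v.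
have DE v : (v \in D) = ~~ (g v < s).
  by rewrite inE eqn_leq gs /= -leqNgt.
have g'D u v : g u < s -> (g' v == g' u) = (g v == g u).
  by rewrite /g' => us; rewrite us; case: ifP => // vs; lia.
have clsD i : s <= i -> cls g' i = \sum_(v in D) (ix v == i - s).
  move=> si; rewrite /cls -sum1_card big_mkcond [RHS]big_mkcond /=.
  apply: eq_bigr => v _; rewrite DE inE /g'; case: (ltnP (g v) s) => vs /=.
    by rewrite ltn_eqF // (leq_trans vs).
  rewrite (_ : (s + ix v == i) = (ix v == i - s)); first by case: eqP.
  by apply/eqP/eqP; lia.
have clsS i : i < s -> cls g' i = cls g i.
  move=> iS; rewrite /cls; apply: eq_card => v; rewrite !inE /g'.
  by case: ifP => // vs; lia.
have sumD i : \sum_(v in D) (ix v == i) = minn (#|D| - i * h) h.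
  by rewrite (sum_index_enum D (fun j => j %/ h == i : nat)) sum_divn_eq.
exists g'.
  move=> i; have [iS|iS] := ltnP i s; first by rewrite clsS ?gh.
  by rewrite clsD // sumD geq_minr.
rewrite -(leq_add2r (\sum_u cls g' (g' u))) sum_cut same_nonadjE.
have [-> ->] : cover_nonadj g' = cover_nonadj g /\ clique_nonadj g' = clique_nonadj g.
  by apply: nonadj_eq => u v /gX us; rewrite eq_sym g'D // eq_sym.
have -> : 2 * k = k + k by rewrite mul2n addnn.
rewrite addnA; apply: leq_trans fg _; rewrite -addnA.
rewrite leq_add2l (bigID (fun u => g u < s)) /= leq_add //.
  rewrite -(sum_labels_lt g s (cls g)) leq_sum // => u us.
  by rewrite clsS /g' us.
rewrite -sum_same_block //.
rewrite -(sum_index_enum D (fun i => \sum_(0 <= j < cls g s) (j %/ h == i %/ h))).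
rewrite (eq_bigl _ _ (fun v => esym (DE v))); apply: leq_sum => u uD.
have us : g u < s = false by apply/negbTE; rewrite -DE.
rewrite /g' us clsD ?leq_addr // addKn.
by rewrite (sum_index_enum D (fun j => (j %/ h == ix u) : nat)).
Qed.

End Blocks.

(** * Exchanging vertices between blocks *)

Section Exchange.
Variables (T : finType) (a : rel T) (X : {set T}) (h k : nat).
Let s := #|X|.
Notation blocks := (blocks X h).
Notation clique_nonadj := (clique_nonadj a X).
Notation nonadj_to := (nonadj_to a X).

(** The part of [fits] that varies when labels on [X] and the last class are kept. The constant
    keeps the difference in the natural numbers; by [clique_nonadj_leq] nothing is truncated. *)
Definition worth g :=
  \sum_(0 <= i < s) cls g i * cls g i
  + (2 * (#|T| * s) - (clique_nonadj g + clique_nonadj g)).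

Lemma nonadj_to_leq g v i : nonadj_to g v i <= s.
Proof. by rewrite /nonadj_to /s -sum1_card; apply: leq_sum => u _; exact: leq_b1. Qed.

Lemma clique_nonadj_leq g : clique_nonadj g <= #|T| * s.
Proof.
apply: (@leq_trans (\sum_(v in ~: X) s)).
  by apply: leq_sum => v _; exact: nonadj_to_leq.
by rewrite sum_nat_const leq_mul2r max_card orbT.
Qed.

Lemma worth_leq g : worth g <= s * (#|T| * #|T|) + 2 * (#|T| * s).
Proof.
rewrite /worth leq_add ?leq_subr //.
rewrite -[s in leqRHS]subn0 -sum_nat_const_nat; apply: leq_sum => i _.
by rewrite leq_mul // max_card.
Qed.

Lemma cls_move g (S : {set T}) i j : S \subset [set v | g v == i] -> i != j ->
  let g' v := if v \in S then j else g v in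
  [/\ cls g' i + #|S| = cls g i, cls g' j = cls g j + #|S|
    & forall l, l != i -> l != j -> cls g' l = cls g l].
Proof.
move=> /subsetP Si ij g'; have Sg v : v \in S -> g v = i.
  by move=> /Si; rewrite inE => /eqP.
split.
- rewrite /cls -(cardsID S [set v | g v == i]) addnC; congr (_ + _).
    apply: eq_card => v; rewrite !inE; case: (boolP (v \in S)) => vS; rewrite ?andbF //.
    by rewrite (Sg v vS) eqxx.
  apply: eq_card => v; rewrite !inE /g'; case: (v \in S) => //=.
  by rewrite eq_sym (negbTE ij).
- rewrite /cls -(cardsID S [set v | g' v == j]) addnC; congr (_ + _).
    apply: eq_card => v; rewrite !inE /g'; case: (boolP (v \in S)) => //= vS.
    by rewrite (Sg v vS) (negbTE ij).
  apply: eq_card => v; rewrite !inE /g'; case: (boolP (v \in S)); rewrite ?eqxx ?andbF //.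
- move=> l li lj; apply: eq_card => v; rewrite !inE /g'; case: ifP => // /Sg ->.
  by rewrite eq_sym (negbTE lj) eq_sym (negbTE li).
Qed.

(* Moving [s + 1] clique vertices into the larger block gains [(s + 1) ^ 2]
   pairs and costs at most [(s + 1) * s] nonadjacent ones. *)
Lemma worth_move g i j : blocks g -> i < s -> j < s -> i != j ->
  s + s < cls g i -> cls g i <= cls g j -> cls g j + s < h ->
  exists g', [/\ blocks g', {in X, g' =1 g}, cls g' s = cls g s
    & worth g < worth g'].
Proof.
move=> [gX gs gh] iS jS ij big_i ij_le small_j.
(* Block [i] has more than [2 * s] vertices, at most [s] of them in [X]: this is where the threshold
   comes from. The other threshold leaves room for [s + 1] vertices in block [j]. *)
have /card_geqP[l [ul sl lS]] : s.+1 <= #|[set v | g v == i] :\: X|.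
  have := cardsID X [set v | g v == i]; rewrite -/(cls g i).
  have : #|[set v | g v == i] :&: X| <= s by apply: subset_leq_card; exact: subsetIr.
  by lia.
pose S := [set v in l].
have memS v : (v \in S) = (v \in l) by rewrite /S inE.
have cS : #|S| = s.+1 by rewrite cardsE (card_uniqP ul).
have Si : S \subset [set v | g v == i].
  by apply/subsetP=> v; rewrite memS => /lS /setDP[].
have SX v : v \in S -> v \notin X.
  by rewrite memS => /lS /setDP[].
have [] := cls_move Si ij; set g' := fun v => _ => ci cj cl; rewrite cS in ci cj.
have g'X : {in X, g' =1 g}.
  by move=> v vX; rewrite /g'; case: ifP => // /SX; rewrite vX.
exists g'; split=> //.
- split=> [v vX|v|l' lS']; first by rewrite g'X ?gX.
    by rewrite /g'; case: ifP => // _; exact: ltnW.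
  have [->|li] := eqVneq l' i; first by have := gh _ iS; lia.
  have [->|lj] := eqVneq l' j; first by lia.
  by rewrite cl ?gh.
- by apply: cl; rewrite gtn_eqF.
have cn : clique_nonadj g' <= clique_nonadj g + s.+1 * s.
  rewrite -cS -sum_nat_const [X in _ + X]big_mkcond /= /clique_nonadj.
  apply: (@leq_trans (\sum_(v in ~: X) (nonadj_to g v (g v) + (if v \in S then s else 0)))).
    apply: leq_sum => v _; rewrite /g'; case: ifP => vS.
      by apply: leq_trans (nonadj_to_leq _ _ _) (leq_addl _ _).
    rewrite addn0 leq_eqVlt; apply/orP; left; apply/eqP.
    by apply: eq_bigr => u uX; rewrite -/g' -[if _ then _ else _]/(g' u) g'X.
  rewrite big_split /= leq_add2l [leqRHS](bigID (mem (~: X))) /= leq_addr //.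
have := clique_nonadj_leq g; have := clique_nonadj_leq g'.
rewrite /worth !big_mkord.
have ij' : Ordinal jS != Ordinal iS by rewrite -val_eqE /= eq_sym.
rewrite (bigD1 (Ordinal iS)) // [in ltnRHS](bigD1 (Ordinal iS)) //=.
rewrite (bigD1 (Ordinal jS)) // [in ltnRHS](bigD1 (Ordinal jS)) //=.
rewrite (eq_bigr (fun m : 'I_s => cls g' m * cls g' m)); last first.
  by move=> m /andP[mi mj]; rewrite cl.
rewrite cj -ci in ij_le *; move: cn.
set q := \sum_(_ | _) _; move: (cls g j) (cls g' i) ij_le => cj0 ci0.
move: (clique_nonadj g) (clique_nonadj g') (#|T| * s) => x y z.
clear; move: s => s0; nia.
Qed.

(** A labelling of maximal [worth] is taken among those that agree with [g0] on [X] and in the size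
    of the last class. It still fits, and two blocks of intermediate size would contradict
    [worth_move]. *)
Lemma few_mid_blocks g0 : blocks g0 -> fits a X h k g0 ->
  exists g w, [/\ blocks g, fits a X h k g, w <= #|T|
    & forall i, i < s -> [|| cls g i <= s + s, h <= cls g i + s | cls g i == w]].
Proof.
move=> b0 f0.
pose A g := [/\ blocks g, {in X, g =1 g0} & cls g s = cls g0 s].
have A0 : A g0 by split.
have [g [bg gX gs] gmax] :=
  ex_maximal (ex_intro A g0 A0) (fun g _ => worth_leq g).
have fg : fits a X h k g.
  have := gmax g0 A0; move: f0.
  rewrite /fits gs; have -> : cover_nonadj a X g = cover_nonadj a X g0.
    by apply: eq_bigr => u uX; apply: eq_bigr => v vX; rewrite !gX.
  have := clique_nonadj_leq g; have := clique_nonadj_leq g0.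
  by rewrite /worth -/s; lia.
pose mid i := [&& i < s, s + s < cls g i & cls g i + s < h].
have uniq_mid i j : mid i -> mid j -> i != j -> cls g i <= cls g j -> False.
  move=> /and3P[iS i1 i2] /and3P[jS j1 j2] ij le.
  have [g' [b' X' s' lt]] := worth_move bg iS jS ij i1 le j2.
  have A' : A g' by split=> [//|v vX|]; [rewrite X' ?gX | rewrite s'].
  by have := gmax _ A'; rewrite leqNgt lt.
have [[i mi]|no] := classic (exists i, mid i); last first.
  (* Without an intermediate block the free size is irrelevant; 0 serves. *)
  exists g, 0; split=> // i iS; apply/or3P.
  have [?|?] := leqP (cls g i) (s + s); first exact: Or31.
  have [?|?] := leqP h (cls g i + s); first exact: Or32.
  by case: no; exists i; apply/and3P.
exists g, (cls g i); split=> // [|j jS]; first exact: max_card.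
have [->|ji] := eqVneq j i; first by rewrite eqxx !orbT.
apply/or3P.
have [?|?] := leqP (cls g j) (s + s); first exact: Or31.
have [?|?] := leqP h (cls g j + s); first exact: Or32.
have mj : mid j by apply/and3P.
case: (leqP (cls g i) (cls g j)) => [le|/ltnW le].
  by case: (uniq_mid _ _ mi mj _ le); rewrite eq_sym.
by case: (uniq_mid _ _ mj mi _ le).
Qed.

End Exchange.

(** * The greedy matching *)

Section Matching.
Variables (a : nat -> nat -> bool).

Lemma matched_ext Q Q' u v : (forall w, w < u -> Q w = Q' w) ->
  matched Q u v = matched Q' u v.
Proof.
by move=> QQ; rewrite /matched !big_nat; apply: eq_bigr => w /andP[_ /QQ ->].
Qed.

Lemma partner_ext Q Q' u j : (forall w, w < u -> Q w = Q' w) -> j <= u ->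
  partner a Q u j = partner a Q' u j.
Proof.
move=> QQ; elim: j => //= j IH ju; rewrite /is_partner (matched_ext _ QQ) QQ //.
by rewrite IH // ltnW.
Qed.

(** The equation determines [P] entry by entry, because [partner] at [u] reads only entries below
    [u]. *)
Lemma exists_matching n : exists P, forall u, u < n -> P u = partner a P u u.
Proof.
elim: n => [|n [P HP]]; first by exists id.
exists (fun u => if u == n then partner a P n n else P u) => u.
have ext w : w <= n -> (forall v, v < w ->
    P v = (if v == n then partner a P n n else P v)).
  by move=> wn v vw; rewrite ltn_eqF //; lia.
rewrite ltnS leq_eqVlt => /predU1P[->|un].
  by rewrite eqxx; apply: partner_ext => //; exact: ext.
by rewrite (ltn_eqF un) HP //; apply: partner_ext => //; apply: ext; exact: ltnW.
Qed.

Variant partner_spec Q u j : nat -> Prop :=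
| NoPartner of (forall v, v < j -> ~~ is_partner a Q u v) : partner_spec Q u j 0
| Partner v of v < j & is_partner a Q u v : partner_spec Q u j v.+1.

Lemma partnerP Q u j : partner_spec Q u j (partner a Q u j).
Proof.
elim: j => [|j IH] /=; first by constructor.
case: ifP => [pj|npj]; first by rewrite addn1; constructor.
case: IH => [none|v vj pv]; last by constructor=> //; exact: ltnW.
constructor=> v; rewrite ltnS leq_eqVlt => /predU1P[->|]; [by rewrite npj|exact: none].
Qed.

Lemma matched_eq0 Q u v : reflect (forall w, w < u -> Q w != v.+1) (matched Q u v == 0).
Proof.
rewrite /matched addn1; elim: u => [|u IH]; first by rewrite big_geq //; constructor.
rewrite big_nat_recr //= addn_eq0 eqb0.
apply: (iffP andP) => [[/IH H Hu] w|H].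
  by rewrite ltnS leq_eqVlt => /predU1P[->|/H].
by split; [apply/IH => w wu; apply: H; exact: ltnW | apply: H].
Qed.

Variables (G : sgraph) (P : nat -> nat).
Notation n := (num_verts G).
Hypothesis aE : forall u v : 'I_n, a u v = adj u v.
Hypothesis PE : forall u, u < n -> P u = partner a P u u.

Definition match_cover := [set u : 'I_n | in_cover n P u].

Lemma in_coverPn u : reflect (P u = 0 /\ forall w, w < n -> P w != u.+1) (~~ in_cover n P u).
Proof.
rewrite negbK; apply: (iffP andP) => [[/eqP ? /matched_eq0 ?]|[/eqP ? ?]] //.
by split=> //; apply/matched_eq0.
Qed.

Lemma matchP u : u < n -> P u = 0 \/ exists v, [/\ P u = v.+1, v < u, ~~ a u v, P v = 0
  & forall w, w < u -> P w != v.+1].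
Proof.
move=> un; case: (partnerP P u u) (PE un) => [|v vu]; first by left.
by move=> /and3P[? /eqP ? /matched_eq0 ?] ?; right; exists v.
Qed.

(** Of two free nonadjacent vertices, the larger would have had the smaller as a candidate at its
    turn. *)
Lemma cover_clique (u v : 'I_n) :
  u \notin match_cover -> v \notin match_cover -> u != v -> adj u v.
Proof.
suff lt_adj (u' v' : 'I_n) : v' < u' -> u' \notin match_cover -> v' \notin match_cover -> adj u' v'.
  move=> uX vX; rewrite -val_eqE /= neq_ltn => /orP[uv|vu]; last exact: lt_adj.
  by rewrite adj_sym; apply: lt_adj.
rewrite !inE => vu /in_coverPn[u0 _] /in_coverPn[v0 vn].
have := PE (ltn_ord u'); rewrite u0.
case: partnerP => // none _; have := none _ vu; rewrite -aE; apply: contraR => nadj.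
rewrite /is_partner nadj v0 /=; apply/matched_eq0 => w wu.
by apply: vn; exact: ltn_trans (ltn_ord u').
Qed.

(** The matched pairs are disjoint and nonadjacent, so every clique deletion set contains an end of
    each; the cover consists of both ends. *)
Lemma card_cover_leq : #|match_cover| <= 2 * clique_distance G.
Proof.
have [[Y Ydel <-] _] := clique_distanceP G.
pose M := [set u : 'I_n | P u != 0]; pose pr (u : 'I_n) := insubd u (P u).-1.
have prP u : u \in M -> [/\ P u = (pr u).+1, ~~ adj u (pr u), pr u != u, P (pr u) = 0
    & forall w, w < u -> P w != (pr u).+1].
  rewrite inE; case: (matchP (ltn_ord u)) => [-> //|[v [Pu vu nadj Pv vw]] _].
  have vpr : pr u = v :> nat.
    by rewrite /pr Pu /= val_insubd (ltn_trans vu (ltn_ord u)).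
  by rewrite -aE -(inj_eq val_inj) /= vpr; split=> //; rewrite ltn_eqF.
have XM : #|match_cover| <= #|M| + #|M|.
  have sub : match_cover \subset M :|: [set pr u | u in M].
    apply/subsetP=> u; rewrite in_setU inE; apply: contraLR; rewrite negb_or.
    rewrite inE negbK => /andP[/eqP Pu /imsetP no]; apply/in_coverPn; split=> // w wn.
    apply/eqP=> Pw; apply: no.
    have wM : Ordinal wn \in M by rewrite inE /= Pw.
    exists (Ordinal wn) => //; apply: val_inj.
    by have [+ _ _ _ _] := prP _ wM; rewrite /= Pw => -[].
  apply: leq_trans (subset_leq_card sub) _; apply: leq_trans (leq_card_setU _ _) _.
  by rewrite leq_add2l leq_imset_card.
apply: leq_trans XM _; rewrite mul2n -addnn.
suff MY : #|M| <= #|Y| by exact: leq_add.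
(* [M] holds the upper end of each pair; [f] picks an end in [Y], injectively since the pairs are
   disjoint. *)
pose f u := if u \in Y then u else pr u.
rewrite -(card_in_imset (f := f) (D := M)); last first.
  have disj u v : u \in M -> v \in M -> pr u != v.
    move=> /prP[_ _ _ P0 _]; rewrite inE; apply: contra => /eqP <-.
    by rewrite P0.
  move=> u v uM vM; rewrite /f; case: ifP => _; case: ifP => _ //.
  - by move=> E; have := disj v u vM uM; rewrite -E eqxx.
  - by move=> E; have := disj u v uM vM; rewrite E eqxx.
  move=> E; have [Pu _ _ _ Hu] := prP _ uM; have [Pv _ _ _ Hv] := prP _ vM.
  case: (ltngtP u v) => [uv|vu|/val_inj //].
    by have := Hv _ uv; rewrite Pu E eqxx.
  by have := Hu _ vu; rewrite Pv E eqxx.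
apply: subset_leq_card; apply/subsetP=> _ /imsetP[u uM ->]; rewrite /f.
case: ifP => // /negbT uY; have [_ nadj pu _ _] := prP _ uM.
apply: contraR nadj => prY; move/forallP: Ydel => /(_ u) /forallP /(_ (pr u)).
by rewrite uY prY eq_sym pu.
Qed.

Lemma cover_cardE : cover_card n P = #|match_cover|.
Proof.
rewrite /cover_card big_mkord -sum1_card [RHS]big_mkcond; apply: eq_bigr => u _.
by rewrite inE; case: in_cover.
Qed.

Lemma rank_lt u v : u < v -> in_cover n P u -> rank n P u < rank n P v.
Proof.
move=> uv uX; rewrite /rank [ltnRHS](big_cat_nat _ (n := u.+1)) //=.
by rewrite big_nat_recr //= uX; lia.
Qed.

Lemma rank_inj u v : in_cover n P u -> in_cover n P v ->
  rank n P u = rank n P v -> u = v.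
Proof.
move=> uX vX E; case: (ltngtP u v) => // [/rank_lt/(_ uX)|/rank_lt/(_ vX)];
by rewrite E ltnn.
Qed.

Lemma rank_lt_cover_card u : u < n -> in_cover n P u -> rank n P u < cover_card n P.
Proof.
move=> un uX; rewrite /rank /cover_card [ltnRHS](big_cat_nat _ (n := u.+1)) //=.
by rewrite big_nat_recr //= uX; lia.
Qed.

End Matching.

(** * Correctness of the formula *)

Lemma encode_digits b D (f : nat -> nat) : 0 < b -> (forall j, j < D -> f j < b) ->
  exists2 I, I < b ^ D & forall j, j < D -> I %/ b ^ j %% b = f j.
Proof.
move=> b0; elim: D f => [|D IH] f fb; first by exists 0.
have [|I ID HI] := IH (f \o succn); first by move=> j jD; exact: fb.
exists (I * b + f 0) => [|[|j] jD].
- by have := fb 0 isT; rewrite expnSr; nia.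
- by rewrite expn0 divn1 modnMDl modn_small // fb.
by rewrite expnS divnMA divnMDl // (divn_small (fb 0 isT)) addn0 HI.
Qed.

(** The threshold count of [price] is bounded below by any common lower bound; the next lemma bounds
    it above by each term. *)
Lemma sum_count_leq M s (F : nat -> nat) m :
  (m <= M /\ forall i, i < s -> m <= F i) ->
  m <= \sum_(0 <= t < M) (\sum_(0 <= i < s) (F i <= t) == 0).
Proof.
move=> [mM mF]; rewrite (big_cat_nat _ (n := m)) //=.
apply: leq_trans (leq_addr _ _); rewrite -[leqLHS](sum_leq (leqnn m)) !big_nat.
apply: leq_sum => t /andP[_ tm]; rewrite tm lt0b big1_seq ?eqxx // => i /andP[_].
rewrite mem_index_iota => /andP[_ iS]; apply/eqP; rewrite eqb0 -ltnNge.
exact: leq_trans (mF _ iS).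
Qed.

Lemma sum_count_geq M s (F : nat -> nat) i : i < s ->
  \sum_(0 <= t < M) (\sum_(0 <= i < s) (F i <= t) == 0) <= F i.
Proof.
move=> iS; apply: (@leq_trans (\sum_(0 <= t < M) (t < F i))).
  apply: leq_sum => t _; case: ltnP => [|le]; first by rewrite leq_b1.
  rewrite leqn0 eqb0 sum_nat_seq_neq0; apply/hasP; exists i.
    by rewrite mem_index_iota.
  by rewrite le.
elim: M => [|M IH]; first by rewrite big_geq.
rewrite big_nat_recr //=; case: ltnP => [MF|_]; last by rewrite addn0.
rewrite addn1; apply: leq_ltn_trans MF.
apply: (@leq_trans (\sum_(0 <= t < M) 1)); first by apply: leq_sum => t _; exact: leq_b1.
by rewrite sum_nat_const_nat subn0 muln1.
Qed.

Fact dual_leq A B C K S R p i c :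
  A + B + (C + (p + p)) <= K + S + (R + (i + i)) -> c + i <= p ->
  A + B + (C + (c + c)) <= K + S + R.
Proof. by lia. Qed.

Fact primal_leq A B C K S R p i c :
  A + B + (C + (c + c)) <= K + S + R -> p <= c + i ->
  A + B + (C + (p + p)) <= K + S + (R + (i + i)).
Proof. by lia. Qed.

Section Decide.
Variables (a : nat -> nat -> bool) (G : sgraph) (P : nat -> nat) (k h : nat).
Notation n := (num_verts G).
Hypothesis aE : forall u v : 'I_n, a u v = adj u v.
Hypothesis h0 : 0 < h.
Notation X := (match_cover G P).
Notation s := (cover_card n P).
Let sX : s = #|X| := cover_cardE G P.

Lemma in_coverE (u : 'I_n) : (u \in X) = in_cover n P u.
Proof. by rewrite inE. Qed.

Lemma n_edgesE : n_edges n a = \sum_(u < n) \sum_(v < n) (adj u v : nat).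
Proof.
rewrite /n_edges big_mkord; apply: eq_bigr => u _; rewrite big_mkord.
by apply: eq_bigr => v _; rewrite aE.
Qed.

Lemma card_coverC : n - s = #|~: X|.
Proof. by rewrite cardsCs setCK card_ord sX. Qed.

Section FixedLabels.
Variables (y : nat) (g : 'I_n -> nat).
Hypothesis gE : forall u, u \in X -> g u = lab n P y u.

Lemma lab_cardE i : lab_card n P y i = #|[set u in X | g u == i]|.
Proof.
rewrite /lab_card big_mkord -sum1_card [RHS]big_mkcond; apply: eq_bigr => u _.
rewrite [in RHS]inE in_coverE; case: (boolP (in_cover n P u)) => //= uX.
by rewrite -gE ?in_coverE //; case: eqP.
Qed.

Lemma nonnbrsE (v : 'I_n) i : nonnbrs n a P y v i = nonadj_to (@adj G) X g v i.
Proof.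
rewrite /nonnbrs /nonadj_to big_mkord [RHS]big_mkcond; apply: eq_bigr => u _.
rewrite in_coverE; case: (boolP (in_cover n P u)) => //= uX.
by rewrite -gE ?in_coverE // aE.
Qed.

Lemma innerE : inner n a P y = cover_nonadj (@adj G) X g.
Proof.
rewrite /inner /cover_nonadj big_mkord [RHS]big_mkcond; apply: eq_bigr => u _.
rewrite big_mkord in_coverE; case: (boolP (in_cover n P u)) => uX; last by rewrite big1.
rewrite [RHS]big_mkcond; apply: eq_bigr => v _.
rewrite in_coverE; case: (boolP (in_cover n P v)) => //= vX.
by rewrite -!gE ?in_coverE // aE.
Qed.

Lemma clsE i : cls g i = lab_card n P y i + #|[set v in ~: X | g v == i]|.
Proof.
rewrite lab_cardE /cls -(cardsID X); congr (_ + _); apply: eq_card => v;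
  by rewrite !inE andbC.
Qed.

Lemma sum_clique_labels (F : nat -> nat) :
  (forall v, v \notin X -> g v <= s) ->
  \sum_(v in ~: X) F (g v) =
  \sum_(0 <= i < s) F i * #|[set v in ~: X | g v == i]|
    + F s * #|[set v in ~: X | g v == s]|.
Proof.
move=> gs; transitivity (\sum_(v in ~: X | g v < s.+1) F (g v)).
  apply: eq_bigl => v; case: (boolP (v \in ~: X)) => //=.
  by rewrite in_setC ltnS => /gs ->.
rewrite sum_labels_in big_nat_recr //= mulnC; congr (_ + _).
by apply: eq_bigr => i _; rewrite mulnC.
Qed.

Lemma pricesE z : prices n a P y z = \sum_(v in ~: X) price n a P y z v.
Proof.
rewrite /prices big_mkord [RHS]big_mkcond; apply: eq_bigr => v _.
by rewrite in_setC in_coverE; case: in_cover; rewrite ?muln0 ?muln1.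
Qed.

End FixedLabels.

Notation H := (cap n h).

Lemma valid_blocks y w :
  valid n h P y w ->
  [/\ forall u, u \in X -> lab n P y u < s,
      forall i, i < s -> lab_card n P y i <= blk n h P y w i <= H
    & blks n h P y w <= n].
Proof.
case/and3P=> V1 V2 V3; split=> // [u uX|i iS].
  rewrite ltnNge; apply/negP => bad; move: V1; apply/negP.
  rewrite sum_nat_seq_neq0; apply/hasP; exists (val u); first by rewrite mem_index_iota ltn_ord.
  by rewrite /= -in_coverE uX bad.
apply: contraTT V2 => bad; rewrite sum_nat_seq_neq0; apply/hasP; exists i.
  by rewrite mem_index_iota.
by rewrite /= bad.
Qed.

(** Strong duality: an optimal distribution of the clique has supporting prices, and these are among
    the tested [z]. There every clique vertex has a price at least its cost plus the digit of its
    own label, so the test bounds the cost. *)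
Lemma blocks_of_valid y w : valid n h P y w ->
  (forall z, z < num_codes n P -> test n k h a P y w z) ->
  exists2 g, blocks X H g & fits (@adj G) X H k g.
Proof.
move=> /valid_blocks[labX blkS blksn] tests.
have sn : s <= n by rewrite sX -[leqRHS]card_ord max_card.
have lab0 i : s <= i -> lab_card n P y i = 0.
  move=> si; rewrite (@lab_cardE y (fun u => lab n P y u)) //.
  apply: eq_card0 => u; rewrite !inE; apply/negP => /andP[uX /eqP E].
  by have := labX u; rewrite in_coverE => /(_ uX); rewrite E ltnNge si.
have sum_lab : \sum_(0 <= i < s) lab_card n P y i = s.
  rewrite [RHS]sX -sum1_card.
  rewrite (eq_bigr (fun i => #|[set u in X | lab n P y (val u) == i]| * 1)); last first.
    by move=> i _; rewrite muln1; apply: lab_cardE.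
  rewrite -(sum_labels_in (fun u : 'I_n => lab n P y u) X s (fun=> 1)).
  by apply: eq_bigl => u; case: (boolP (u \in X)) => //= /labX ->.
(* The places left for clique vertices once the cover is placed; label [s] takes the rest. *)
pose room i := if i < s then blk n h P y w i - lab_card n P y i else rest n h P y w.
have room_sum : \sum_(0 <= i < s.+1) room i = #|~: X|.
  rewrite big_nat_recr //= {2}/room ltnn -card_coverC /rest.
  have : \sum_(0 <= i < s) room i + s = blks n h P y w; last by lia.
  rewrite -{2}sum_lab -big_split /blks; apply: eq_big_nat => i /andP[_ iS] /=.
  by rewrite /room iS subnK //; case/andP: (blkS _ iS).
pose c (v : 'I_n) i := nonnbrs n a P y v i.
have cE v i : c v i = nonadj_to (@adj G) X (fun u => lab n P y u) v i.
  exact: nonnbrsE.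
have cs v i : c v i <= s by rewrite cE sX nonadj_to_leq.
have c_dump v : c v s = 0.
  rewrite cE; apply: big1 => u uX; rewrite ltn_eqF //; exact: labX.
pose good (g : 'I_n -> nat) := (forall v, v \in ~: X -> g v < s.+1) /\
  (forall i, i < s.+1 -> #|[set v in ~: X | g v == i]| = room i).
pose cost (g : 'I_n -> nat) := \sum_(v in ~: X) c v (g v).
have cost_leq g : cost g <= #|~: X| * s.
  by rewrite -sum_nat_const; apply: leq_sum => v _; exact: cs.
have [g0 g0good] := exists_assignment room_sum.
have [g [gs groom] gmax] := ex_maximal (f := fun g => #|~: X| * s - cost g)
  (ex_intro good g0 g0good) (fun g _ => leq_subr _ _).
have [pi [pib pile]] : exists pi : nat -> nat,
  (forall j, j < s.+1 -> pi j <= s.+1 * s) /\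
  (forall v j, v \in ~: X -> j < s.+1 -> c v (g v) + pi (g v) <= c v j + pi j).
  apply: (exists_prices (K := ~: X)) => // g' g's g'E.
  have : good g' by split=> // i iS; rewrite g'E groom.
  by move/gmax; have := cost_leq g; have := cost_leq g'; rewrite /cost; lia.
(* Prices are at most [(s + 1) * s], below [base]. Digits beyond the [s + 1] prices are set to 0. *)
have [||z zN zpi] := @encode_digits (base n P) (s + s + 1)
    (fun j => if j < s.+1 then pi j else 0).
- by rewrite /base; lia.
- move=> j _; case: ifP => [/pib|_]; rewrite /base; last by lia.
  by move: s => s'; nia.
have {}zpi j : j < s.+1 -> digit n P z j = pi j.
  by move=> js; rewrite /digit zpi ?js //; lia.
pose g1 v := if v \in X then lab n P y (val v) else g v.
have g1X u : u \in X -> g1 u = lab n P y u by rewrite /g1 => ->.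
have g1C v : v \in ~: X -> g1 v = g v by rewrite in_setC /g1 => /negbTE ->.
have room1 i : i < s.+1 -> #|[set v in ~: X | g1 v == i]| = room i.
  move=> iS; rewrite -groom //; apply: eq_card => v; rewrite ![v \in [set _ | _ & _]]inE.
  by case: (boolP (v \in ~: X)) => //= /g1C ->.
have cls_blk i : i < s -> cls g1 i = blk n h P y w i.
  move=> iS; rewrite (clsE g1X) room1 ?ltnS ?(ltnW iS) // /room iS subnKC //.
  by case/andP: (blkS _ iS).
have cls_rest : cls g1 s = rest n h P y w.
  by rewrite (clsE g1X) room1 // /room ltnn lab0.
have g1s v : g1 v <= s.
  have [vX|vX] := boolP (v \in X); first by rewrite g1X // ltnW // labX.
  have vC : v \in ~: X by rewrite in_setC.
  by rewrite g1C // -ltnS; exact: gs.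
exists g1.
  split=> [v vX|v|i]; rewrite -sX //; first by rewrite g1X ?labX.
  by move=> iS; rewrite cls_blk //; case/andP: (blkS _ iS).
have := tests _ zN; rewrite /test /fits -sX.
rewrite n_edgesE (innerE g1X) card_coverC cls_rest.
rewrite [X in _ -> _ <= _ + X + _](eq_big_nat _ _
  (F2 := fun i => blk n h P y w i * blk n h P y w i)); last first.
  by move=> i /andP[_ iS]; rewrite cls_blk.
have -> : clique_nonadj (@adj G) X g1 = cost g.
  by apply: eq_bigr => v vX; rewrite g1C // cE; apply: eq_bigr => u uX; rewrite g1X.
have low : cost g + income n h P y w z <= prices n a P y z.
  have -> : income n h P y w z = \sum_(v in ~: X) pi (g v).
    rewrite (eq_bigr (fun v => pi (g1 v))); last by move=> v /g1C ->.
    rewrite (sum_clique_labels pi (fun v _ => g1s v)) /income zpi // room1 //.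
    rewrite {1}/room ltnn; congr (_ + _); apply: eq_big_nat => i /andP[_ iS].
    by rewrite zpi ?room1 ?ltnS ?(ltnW iS) // /room iS.
  rewrite pricesE -big_split /=; apply: leq_sum => v vX.
  apply: sum_count_leq; split.
    by rewrite zpi //; have := pile v s vX (ltnSn _); rewrite c_dump.
  by move=> i iS; rewrite zpi ?ltnS ?(ltnW iS) //; apply: pile; rewrite ?ltnS ?(ltnW iS).
by move=> T; apply: (dual_leq T low).
Qed.

(** Weak duality: for any [z], the price of a clique vertex is at most its cost plus the digit of
    its own label, so every test follows from [fits]. *)
Lemma valid_of_blocks g w : blocks X H g -> fits (@adj G) X H k g -> w <= n ->
  (forall i, i < s -> [|| cls g i <= s + s, H <= cls g i + s | cls g i == w]) ->
  exists2 y, y < num_codes n P &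
    valid n h P y w /\ forall z, test n k h a P y w z.
Proof.
rewrite /blocks /fits -sX => -[gX gs gh] gfits wn near.
(* Digit [j] is a label for [j < s] and a size code for [s <= j < s + s]; the last digit is
   arbitrary. *)
pose Q j x := [/\ x < base n P,
  j < s -> forall u : 'I_n, u \in X -> rank n P u = j -> g u = x
  & s <= j -> j < s + s -> blk_of_digit n h P x w = cls g (j - s)].
have s_lt_base : s < base n P by rewrite /base; lia.
have [j _|f Hf] := @choice_below nat 0 Q (s + s + 1).
  have [js|js] := ltnP j s.
    have [u /andP[uX /eqP uj]|none] := pickP (fun u : 'I_n => (u \in X) && (rank n P u == j)).
      exists (g u); split=> [||]; [exact: ltn_trans (gX u uX) _ | | lia].
      move=> _ v vX vj; congr g; apply: val_inj; apply: (@rank_inj G P).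
      - by rewrite -in_coverE.
      - by rewrite -in_coverE.
      - by rewrite vj.
    exists 0; split=> [||]; [lia | | lia].
    by move=> _ u uX /eqP uj; have := none u; rewrite uX uj.
  have [js2|js2] := ltnP j (s + s); last first.
    by exists 0; split=> [||]; [lia | lia | move=> ?; rewrite ltnNge js2].
  have iS : j - s < s by lia.
  have := near _ iS; have := gh _ iS; set x := cls g (j - s) => xH.
  have [x2 _|x2 /=] := leqP x (s + s).
    exists x; split=> [||_ _]; [rewrite /base; lia | lia |].
    by rewrite /blk_of_digit -/x x2.
  have [xb _|xb /= /eqP xw] := leqP H (x + s).
    (* The codes after [s + s] count downwards from [H]. *)
    exists (s + s + 1 + (H - x)); split=> [||_ _]; [rewrite /base; lia | lia |].
    by rewrite /blk_of_digit ifN ?ifT; lia.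
  (* The first digit beyond all fixed sizes, which stands for [w]. *)
  exists (s + s + s + 2); split=> [||_ _]; [rewrite /base; lia | lia |].
  by rewrite /blk_of_digit !ifN -?xw //; lia.
have [||y yN ydig] := @encode_digits (base n P) (s + s + 1) f.
- by lia.
- by move=> j /Hf[].
have gE u : u \in X -> g u = lab n P y u.
  move=> uX; have rs : rank n P u < s.
    by apply: rank_lt_cover_card => //; rewrite -in_coverE.
  have ru : rank n P u < s + s + 1 by lia.
  by have [_ /(_ rs u uX erefl) -> _] := Hf _ ru; rewrite /lab /digit ydig.
have blkE i : i < s -> blk n h P y w i = cls g i.
  move=> iS; have ji : s + i < s + s + 1 by lia.
  have [_ _ /(_ (leq_addr _ _))] := Hf _ ji.
  by rewrite ltn_add2l addKn /blk /digit ydig // => /(_ iS).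
have sum_cls : \sum_(0 <= i < s) cls g i + cls g s = n.
  rewrite -big_nat_recr //= -[RHS]card_ord -sum1_card.
  transitivity (\sum_(u | g u < s.+1) 1); last first.
    by apply: eq_bigl => u; rewrite ltnS gs.
  rewrite (sum_labels_lt g s.+1 (fun=> 1)).
  by apply: eq_bigr => i _; rewrite muln1.
have blksE : blks n h P y w = \sum_(0 <= i < s) cls g i.
  by apply: eq_big_nat => i /andP[_ /blkE].
have restE : rest n h P y w = cls g s by rewrite /rest blksE; lia.
exists y => //; split.
  apply/and3P; split; last by rewrite blksE; lia.
    rewrite -leqn0 big_nat big1 // => u /andP[_ un]; apply/eqP; rewrite eqb0.
    apply/negP => /andP[uX]; apply/negP; rewrite -ltnNge.
    by rewrite -[u]/(val (Ordinal un)) -gE ?gX // in_coverE.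
  rewrite -leqn0 big_nat big1 // => i /andP[_ iS]; apply/eqP.
  by rewrite eqb0 negbK blkE // gh // (clsE gE) leq_addr.
move=> z; move: gfits; rewrite /test n_edgesE (innerE gE) card_coverC restE.
rewrite [X in _ -> _ <= _ + X + _](eq_big_nat _ _ (F2 := fun i => cls g i * cls g i)); last first.
  by move=> i /andP[_ iS]; rewrite blkE.
have up : prices n a P y z <= clique_nonadj (@adj G) X g + income n h P y w z.
  have -> : income n h P y w z = \sum_(v in ~: X) digit n P z (g v).
    rewrite (sum_clique_labels _ (fun v _ => gs v)) /income restE; congr (_ + _).
      apply: eq_big_nat => i /andP[_ iS].
      by rewrite blkE // (clsE gE) addKn.
    rewrite (clsE gE) (lab_cardE gE) (_ : [set u in X | _] = set0) ?cards0 //.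
    by apply/setP=> u; rewrite !inE -in_coverE; case: (boolP (u \in X)) => //= /gX; lia.
  rewrite pricesE -big_split /=; apply: leq_sum => v vX.
  rewrite -(nonnbrsE gE); have := gs v; rewrite leq_eqVlt => /predU1P[->|vs].
    apply: leq_trans (leq_addl _ _); rewrite /price.
    apply: (@leq_trans (\sum_(0 <= t < digit n P z s) 1)).
      by apply: leq_sum => t _; exact: leq_b1.
    by rewrite sum_nat_const_nat subn0 muln1.
  exact: (sum_count_geq _ (fun i => nonnbrs n a P y v i + digit n P z i) vs).
by move=> T; apply: (primal_leq T up).
Qed.

Lemma decide_gt0P : reflect (exists y w, [/\ y < num_codes n P, w <= n, valid n h P y w
    & forall z, z < num_codes n P -> test n k h a P y w z]) (0 < decide n k h a P).
Proof.
rewrite lt0n sum_nat_seq_neq0; apply: (iffP hasP).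
  move=> [y]; rewrite mem_index_iota /= sum_nat_seq_neq0 => yN /hasP[w].
  rewrite mem_index_iota addn1 ltnS /= eqb0 negbK => wn /andP[V].
  rewrite sum_nat_seq_eq0 => /allP Z; exists y, w; split=> // z zN.
  by have := Z z; rewrite mem_index_iota => /(_ zN); rewrite /= eqb0 negbK.
move=> [y [w [yN wn V Z]]]; exists y; first by rewrite mem_index_iota.
rewrite /= sum_nat_seq_neq0; apply/hasP; exists w; first by rewrite mem_index_iota addn1.
rewrite /= V eqb0 negbK sum_nat_seq_eq0; apply/allP => z; rewrite mem_index_iota => zN.
by rewrite /= Z.
Qed.

Lemma decideP : reflect (exists2 g, blocks X H g & fits (@adj G) X H k g)
  (0 < decide n k h a P).
Proof.
apply: (iffP decide_gt0P) => [[y [w [_ _ V Z]]]|[g bg fg]].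
  exact: blocks_of_valid V Z.
have [g' [w [b' f' wn near]]] := few_mid_blocks bg fg.
have [||y yN [V Z]] := @valid_of_blocks g' w b' f'.
- by rewrite card_ord in wn.
- by move=> i; rewrite sX; exact: near.
by exists y, w; split=> //; rewrite card_ord in wn.
Qed.

End Decide.

(** * The algorithm *)

Lemma nth_allpairs (A B C : Type) (F : A -> B -> C) s t a0 b0 c0 i j :
  i < size s -> j < size t ->
  nth c0 [seq F u v | u <- s, v <- t] (i * size t + j) = F (nth a0 s i) (nth b0 t j).
Proof.
elim: s i => // u s IH [|i] /= si tj; rewrite nth_cat size_map.
  by rewrite mul0n add0n tj (nth_map b0).
by rewrite ltnNge mulSn -addnA leq_addr /= addKn IH.
Qed.

Definition code_adj (x : instance) (u v : nat) : bool :=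
  nth 0 (encode x) (3 + (u * num_verts (graph x) + v)) == 1.

Lemma nth_encode (x : instance) (u v : 'I_(num_verts (graph x))) :
  nth 0 (encode x) (3 + (u * num_verts (graph x) + v)) = adj u v.
Proof.
rewrite /= -[X in u * X + v](size_enum_ord (num_verts (graph x))).
by rewrite (nth_allpairs _ u v) ?size_enum_ord ?ltn_ord // !nth_ord_enum.
Qed.

Lemma code_adjE (x : instance) (u v : 'I_(num_verts (graph x))) :
  code_adj x u v = adj u v.
Proof. by rewrite /code_adj nth_encode; case: adj. Qed.

Lemma decide_correct (x : instance) P :
  (forall u, u < num_verts (graph x) -> P u = partner (code_adj x) P u u) ->
  0 < decide (num_verts (graph x)) (budget x) (bound x) (code_adj x) P <->
  tree_free_edge_deletion x.
Proof.
set n := num_verts (graph x) => PE.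
have clq := cover_clique (@code_adjE x) PE.
have c0 : 0 < cap n (bound x) by apply: cap_gt0; exact: bound_gt0.
have asym := @adj_sym (graph x); have airr := @adj_irr (graph x).
(* No class has more than [n] vertices, so capping the bound at [n + 1] changes nothing. *)
have capE m : m <= n -> (m <= cap n (bound x)) = (m <= bound x) by rewrite /cap; lia.
have cls_n (g : 'I_n -> nat) i : cls g i <= n.
  by rewrite -[leqRHS]card_ord; exact: max_card.
rewrite labelled_iff; split.
  move/(decideP _ _ (@code_adjE x) (bound_gt0 x)) => [g bg fg].
  have [g' g'h cut] := labels_of_blocks asym airr clq c0 bg fg.
  by exists g'; split=> // i; rewrite -capE ?g'h // cls_n.
move=> [g [gh cut]]; apply/(decideP _ _ (@code_adjE x) (bound_gt0 x)).
apply: (blocks_of_labels asym airr clq c0 _ cut) => i.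
by rewrite capE ?gh // cls_n.
Qed.

(** * Running time *)

Lemma input_size_geq w : size w <= input_size w.
Proof. by rewrite /input_size -sum1_size; apply: leq_sum => i _. Qed.

Lemma num_verts_lt_input_size (x : instance) :
  num_verts (graph x) + 3 <= input_size (encode x).
Proof.
apply: leq_trans (input_size_geq _); rewrite /= size_allpairs size_enum_ord.
by case: (num_verts _) => // m; rewrite mulnS; lia.
Qed.

Definition t_codes_bound :=
  let b := TAdd (TAdd (TGet 0 (cst 0)) (TGet 0 (cst 0))) (cst 3) in
  let m := TAdd (TGet 0 (cst 0)) (TGet 0 (cst 0)) in
  t_exp (t_mul b b) (TAdd (TAdd m m) (cst 1)).

(** [num_codes] for a cover of [l + l] vertices, the largest that the matching can give at parameter
    [l]. *)
Definition codes_bound l := ((l + l + 3) * (l + l + 3)) ^ (l + l + (l + l) + 1).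

Lemma codes_bound_computable d : computable (fun l => codes_bound l ^ d).
Proof.
apply: (@term_computable (t_exp t_codes_bound (cst d))) => l.
set N := codes_bound l; exists (N ^ d + N + d + l * 4 + 4).
have ev_l env : ev (N ^ d + N + d + l * 4 + 4) (load [:: l]) env (TGet 0 (cst 0)) l.
  by apply: ev_eq (ev_get _ (ev_const _ _ _ 0)) _.
have ev_2l env : ev (N ^ d + N + d + l * 4 + 4) (load [:: l]) env
    (TAdd (TGet 0 (cst 0)) (TGet 0 (cst 0))) (l + l) by exact: ev_add.
apply: ev_exp; last by lia.
- apply: ev_exp.
  + by apply: ev_mul; [| |lia]; apply: ev_add => //; exact: ev_const.
  + by apply: ev_add; [exact: ev_add | exact: ev_const].
  + by lia.
  + by lia.
  + by rewrite -/(codes_bound l) -/N; lia.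
- exact: ev_const.
- by rewrite /N /codes_bound expn_gt0; lia.
- by lia.
Qed.

Lemma num_codes_leq (x : instance) P :
  (forall u, u < num_verts (graph x) -> P u = partner (code_adj x) P u u) ->
  num_codes (num_verts (graph x)) P <= codes_bound (clique_distance (graph x)).
Proof.
move=> PE; have := card_cover_leq (@code_adjE x) PE; rewrite -cover_cardE mul2n -addnn.
rewrite /num_codes /base /codes_bound; set s := cover_card _ _; set l := clique_distance _.
move=> sl; apply: (@leq_trans (((s + 3) * (s + 3)) ^ (l + l + (l + l) + 1))).
  by apply: leq_pexp2l; lia.
by rewrite leq_exp2r ?leq_mul //; lia.
Qed.

(** The program costs at most as much as one fold with bound [e] and a body containing [E], so
    [time_poly] applies. *)
Lemma program_time_poly E e : exists C d, forall W,
  W * (time W E + 40) + time W e + 40 <= C * W.+1 ^ d.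
Proof.
have [C [d timeP]] := time_poly (TFold e (cst 0) (TAdd E (cst 0))).
by exists C, d => W; apply: leq_trans (timeP W) => /=; lia.
Qed.

Theorem theorem3 :
  fpt encode tree_free_edge_deletion (fun x : instance => clique_distance (graph x)).
Proof.
have [C [d timeP]] := program_time_poly t_match_next t_decide.
exists (fun l => codes_bound l ^ d); split; first exact: codes_bound_computable.
(* [3 * d] comes from [W.+1 <= N * L ^ 3]; the factor [L ^ C] absorbs the constant [C]. *)
exists (program t_match_next t_decide), (3 * d + C) => x.
set n := num_verts (graph x); set w := encode x; set L := input_size w.
have [P PE] := exists_matching (code_adj x) n.
set N := num_codes n P; pose W := N + (n + n + 10) + 1.
have wE u v : u < n -> v < n -> nth 0 w (3 + (u * n + v)) = code_adj x u v.
  move=> un vn; rewrite (nth_encode (Ordinal un) (Ordinal vn)).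
  by rewrite -code_adjE.
have [t [m [E tT o]]] : runs (program t_match_next t_decide) (load w)
    (W * (time W t_match_next + 40) + time W t_decide + 40)
    (fun m => output m = decide n (budget x) (bound x) (code_adj x) P).
  apply: (@runs_program _ _ P) => [|u un|]; first by rewrite /= /W; lia.
    rewrite (PE u un).
    apply: (@ev_match_next _ _ n (budget x) (bound x)) => //; rewrite /W; try lia.
    by move=> v vu; rewrite /table /= vu.
  apply: ev_decide => //; rewrite ?/W -?/N; try lia; last exact: bound_gt0.
  by move=> v vn; rewrite /table /= vn.
exists t, m; split=> //; last by rewrite o; exact: decide_correct.
apply: leq_trans tT _; apply: leq_trans (timeP W) _.
have Ln : n + 3 <= L := num_verts_lt_input_size x.
have N0 : 0 < N by rewrite /N /num_codes expn_gt0 /base; lia.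
(* As [N] is positive, the sum of [N] and a linear term in [n] is at most a product, which separates
   the parameter from the input size. *)
have WL : W.+1 <= N * L ^ 3.
  apply: (@leq_trans (N * (n + n + 13))); first by rewrite /W; nia.
  rewrite leq_mul2l orbC; apply/orP; left.
  apply: (@leq_trans ((n + 3) ^ 3)); last by rewrite leq_exp2r.
  by rewrite !expnS expn0; nia.
have CL : C <= L ^ C.
  apply: ltnW; apply: leq_trans (ltn_expl C (ltnSn 1)) _.
  by case: (C) => // C'; rewrite leq_exp2r //; lia.
have := num_codes_leq PE; rewrite -/n -/N; move: (codes_bound _) => F NF.
rewrite expnD mulnA mulnC leq_mul //.
apply: (@leq_trans ((N * L ^ 3) ^ d)).
  by case: (d) => // d'; rewrite leq_exp2r.
rewrite expnMn -expnM leq_mul //.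
by case: (d) => // d'; rewrite leq_exp2r.
Qed.
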